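(* Suppose that the KKT system (K) has a nonempty solution set and that the self-adjoint operators $\mathcal D_i:\mathbb Y_i\to\mathbb Y_i$ satisfy $$\tfrac12\widehat\Sigma^f_{ii}+\sigma\mathcal F_i\mathcal F_i^*+\mathcal D_i\succ0\ (i=1,\dots,s)\quad\text{and}\quad\mathcal D:=\operatorname{Diag}(\mathcal D_1,\dots,\mathcal D_s)\succeq-\tfrac12\widehat\Sigma^f .$$ Let $\{(x^k,y^k,z^k)\}$ be a sequence generated by Algorithm sGS-iPADMM (with $\tau\in(0,2)$), and define $v^k:=\big(y^k;\Pi_{\operatorname{Range}(\mathcal G)}(z^k)\big)$ for $k\ge0$. Then: (a) $\mathcal T\succeq-\tfrac12\mathcal P$ and $\big\langle v,(\tfrac12\mathcal P+\sigma\mathcal B\mathcal B^*+\mathcal T)v\big\rangle>0$ for all $v\in\mathbb V\setminus\{0\}$; (b) there exists a sequence of nonnegative real numbers $\{\widehat\varepsilon_k\}$ such that $\|(\Delta^k;\gamma^k)\|\le\widehat\varepsilon_k$ for all $k\ge0$ and $\sum_{k=0}^\infty\widehat\varepsilon_k<+\infty$; (c) for all $k\ge0$, $v^{k+1}\approx\operatorname{argmin}_{v\in\mathbb V}\{\mathcal L_\sigma(v;(x^k,v^k))+\tfrac12\|v-v^k\|_{\mathcal T}^2\}$ in the sense that $$(\Delta^k;\gamma^k)\in\partial_v\mathcal L_\sigma(v^{k+1};(x^k,v^k))+\mathcal T(v^{k+1}-v^k)\quad\text{and}\quad\|(\Delta^k;\gamma^k)\|\le\widehat\varepsilon_k .$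$
   Context: $\mathbb X$, $\mathbb Y=\mathbb Y_1\times\cdots\times\mathbb Y_s$, $\mathbb Z$ are finite-dimensional real Hilbert spaces. For self-adjoint $\mathcal O$, $\|\nu\|_{\mathcal O}^2:=\langle\nu,\mathcal O\nu\rangle$ (also if $\mathcal O$ is indefinite). $\dagger$ is the Moore–Penrose pseudoinverse; $\Pi_H$ is the metric projection onto $H$. Problem: $\min_{y\in\mathbb Y,z\in\mathbb Z}\{p(y_1)+f(y)-\langle b,z\rangle\mid\mathcal F^*y+\mathcal G^*z=c\}$, with $p:\mathbb Y_1\to(-\infty,+\infty]$ closed proper convex, $f:\mathbb Y\to\mathbb R$ convex, continuously differentiable with Lipschitz gradient, $\mathcal F:\mathbb X\to\mathbb Y$, $\mathcal G:\mathbb X\to\mathbb Z$ linear, $b\in\mathbb Z$, $c\in\mathbb X$. Write $\mathcal Fx=(\mathcal F_1x;\dots;\mathcal F_sx)$ with $\mathcal F_i:\mathbb X\to\mathbb Y_i$. KKT system (K): $0\in(\partial p(y_1);0)+\nabla f(y)+\mathcal Fx$, $\ \mathcal Gx-b=0$, $\ \mathcal F^*y+\mathcal G^*z=c$. $\widehat\Sigma^f:\mathbb Y\to\mathbb Y$ is self-adjoint positive semidefinite with blocks $\widehat\Sigma^f_{ij}:\mathbb Y_j\to\mathbb Y_i$, such that $f(y)\le\widehat f(y,y'):=f(y')+\langle\nabla f(y'),y-y'\rangle+\tfrac12\|y-y'\|^2_{\widehat\Sigma^f}$ for all $y,y'$. For $\sigma>0$, $$\mathcal L_\sigma(y,z;(x,y')):=p(y_1)+\widehat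 f(y,y')-\langle b,z\rangle+\langle\mathcal F^*y+\mathcal G^*z-c,x\rangle+\tfrac\sigma2\|\mathcal F^*y+\mathcal G^*z-c\|^2 .$$ Algorithm sGS-iPADMM: $\{\tilde\varepsilon_k\}$ is a summable nonnegative sequence, $\tau\in(0,2)$, $(x^0,y^0,z^0)\in\mathbb X\times\mathbb Y\times\mathbb Z$ with $y_1^0\in\operatorname{dom}p$, $\mathcal D_i:\mathbb Y_i\to\mathbb Y_i$ self-adjoint linear. Write $y_{<i}=(y_1;\dots;y_{i-1})$, $y_{>i}=(y_{i+1};\dots;y_s)$. For $k=0,1,\dots$: Step 1. For $i=s,\dots,2$ compute $y_i^{k+1/2}\approx\operatorname{argmin}_{y_i}\{\mathcal L_\sigma((y^k_{<i};y_i;y^{k+1/2}_{>i}),z^k;(x^k,y^k))+\tfrac12\|y_i-y_i^k\|^2_{\mathcal D_i}\}$ such that there is $\tilde\delta_i^k$ with $\|\tilde\delta_i^k\|\le\tilde\varepsilon_k$ and $\tilde\delta_i^k\in\partial_{y_i}\mathcal L_\sigma((y^k_{<i};y_i^{k+1/2};y^{k+1/2}_{>i}),z^k;(x^k,y^k))+\mathcal D_i(y_i^{k+1/2}-y_i^k)$. Step 2. For $i=1,\dots,s$ compute $y_i^{k+1}\approx\operatorname{argmin}_{y_i}\{\mathcal L_\sigma((y^{k+1}_{<i};y_i;y^{k+1/2}_{>i}),z^k;(x^k,y^k))+\tfrac12\|y_i-y_i^k\|^2_{\mathcal D_i}\}$ such that there is $\delta_i^k$ with $\|\delta_i^k\|\le\tilde\varepsilon_k$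 and $\delta_i^k\in\partial_{y_i}\mathcal L_\sigma((y^{k+1}_{<i};y_i^{k+1};y^{k+1/2}_{>i}),z^k;(x^k,y^k))+\mathcal D_i(y_i^{k+1}-y_i^k)$. Step 3. Compute $z^{k+1}\approx\operatorname{argmin}_z\mathcal L_\sigma(y^{k+1},z;(x^k,y^k))$ such that $\|\gamma^k\|\le\tilde\varepsilon_k$, where $\gamma^k:=\nabla_z\mathcal L_\sigma(y^{k+1},z^{k+1};(x^k,y^k))=\mathcal Gx^k-b+\sigma\mathcal G(\mathcal F^*y^{k+1}+\mathcal G^*z^{k+1}-c)$. Step 4. $x^{k+1}:=x^k+\tau\sigma(\mathcal F^*y^{k+1}+\mathcal G^*z^{k+1}-c)$. Further definitions. $\mathcal N:=\widehat\Sigma^f+\sigma\mathcal F\mathcal F^*+\mathcal D=\mathcal N_d+\mathcal N_u+\mathcal N_u^*$, with $\mathcal N_d$ the block-diagonal part and $\mathcal N_u$ the strictly block-upper-triangular part; $\mathcal N_{\rm sGS}:=\mathcal N_u\mathcal N_d^{-1}\mathcal N_u^*$. With $\tilde\delta_1^k:=\delta_1^k$, $\tilde\delta^k:=(\tilde\delta_1^k;\dots;\tilde\delta_s^k)$, $\delta^k:=(\delta_1^k;\dots;\delta_s^k)$, put $\delta^k_{\rm sGS}:=\delta^k+\mathcal N_u\mathcal N_d^{-1}(\delta^k-\tilde\delta^k)$. Then $$\Delta^k:=\delta_{\rm sGS}^k-\mathcal F\mathcal G^*[\mathcal G\mathcal G^*]^\dagger\big(\gamma^{k-1}-\gamma^k-\mathcal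 G(x^{k-1}-x^k)\big),\quad k\ge0,$$ with the convention $x^{-1}:=x^0-\tau\sigma(\mathcal F^*y^0+\mathcal G^*z^0-c)$, $\gamma^{-1}:=-b+\mathcal Gx^{-1}+\sigma\mathcal G(\mathcal F^*y^0+\mathcal G^*z^0-c)$. $$\mathcal T(y;z):=\big((\mathcal D+\mathcal N_{\rm sGS}+\sigma\mathcal F\mathcal G^*[\mathcal G\mathcal G^*]^\dagger\mathcal G\mathcal F^* )y;\ 0\big).$$ $\mathbb V:=\mathbb Y\times\operatorname{Range}(\mathcal G)$; $\mathcal B:\mathbb X\to\mathbb V$, $\mathcal Bx:=(\mathcal Fx;\mathcal Gx)$; $\mathcal P:\mathbb V\to\mathbb V$, $\mathcal P(y,z):=(\widehat\Sigma^fy;0)$; $\mathcal T$ is also regarded as an operator on $\mathbb V$. For $v=(y,z),v'=(y',z')\in\mathbb V$, $\mathcal L_\sigma(v;(x,v')):=\mathcal L_\sigma(y,z;(x,y'))$. *)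

(* Defs.v *)
From HB Require Import structures.
From mathcomp Require Import all_boot all_order all_algebra.
From mathcomp Require Import all_classical all_reals all_analysis.
From mathcomp Require Import ring.

Set Implicit Arguments.
Unset Strict Implicit.
Unset Printing Implicit Defensive.

Import Order.TTheory GRing.Theory Num.Theory.
Import numFieldNormedType.Exports.

Local Open Scope classical_set_scope.
Local Open Scope ring_scope.

HB.mixin Record isFinHilbert (R : realType) V
    & NormedModule R V & Vector R V := {
  hdot : V -> V -> R ;
  hdotC : forall x y, hdot x y = hdot y x ;
  hdotDl : forall x y z, hdot (x + y) z = hdot x z + hdot y z ;
  hdotZl : forall (a : R) x y, hdot (a *: x) y = a * hdot x y ;
  hdot_norm : forall x, hdot x x = `|x| ^+ 2
}.

#[short(type="hilbertType")]
HB.structure Definition FinHilbert (R : realType) :=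
  {V of NormedModule R V & Vector R V & isFinHilbert R V}.

Notation "''[' u , v ]" := (hdot u v) : ring_scope.

HB.factory Record Vector_isFinHilbert (R : realType) V & Vector R V := {
  dot : V -> V -> R ;
  dotC : forall x y, dot x y = dot y x ;
  dotDl : forall x y z, dot (x + y) z = dot x z + dot y z ;
  dotZl : forall (a : R) x y, dot (a *: x) y = a * dot x y ;
  dot_ge0 : forall x, 0 <= dot x x ;
  dot_eq0 : forall x, dot x x = 0 -> x = 0
}.

HB.builders Context R V & Vector_isFinHilbert R V.

Let norm (x : V) : R := Num.sqrt (dot x x).

Let sqr_norm x : norm x ^+ 2 = dot x x.
Proof. by rewrite sqr_sqrtr ?dot_ge0. Qed.

Let cauchy_schwarz x y : dot x y <= norm x * norm y.
Proof.
have [y0|y0] := eqVneq (dot y y) 0.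
  rewrite (dot_eq0 y0) dotC -(scale0r (0 : V)) dotZl mul0r.
  by rewrite mulr_ge0 ?sqrtr_ge0.
have yp : 0 < dot y y by rewrite lt_def y0 dot_ge0.
rewrite (le_trans (ler_norm _))// -sqrtr_sqr -sqrtrM ?dot_ge0// ler_wsqrtr//.
have := dot_ge0 (dot y y *: x + (- dot x y) *: y).
rewrite dotDl !dotZl dotC dotDl !dotZl [X in _ + _ * X]dotC dotDl !dotZl.
rewrite (dotC y x).
rewrite [leRHS](_ : _ = dot y y * (dot x x * dot y y - dot x y ^+ 2)).
  by rewrite pmulr_rge0// subr_ge0.
ring.
Qed.

Let ler_normD x y : norm (x + y) <= norm x + norm y.
Proof.
rewrite -(@ler_pXn2r _ 2)// ?nnegrE ?addr_ge0 ?sqrtr_ge0// sqrrD !sqr_norm.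
have -> : dot (x + y) (x + y) = dot x x + dot x y *+ 2 + dot y y.
  by rewrite dotDl (dotC x) (dotC y) !dotDl (dotC y x); ring.
by rewrite lerD2r lerD2l ler_pMn2r//; exact: cauchy_schwarz.
Qed.

Let normrZ (a : R) x : norm (a *: x) = `|a| * norm x.
Proof.
by rewrite /norm dotZl dotC dotZl mulrA -expr2 sqrtrM ?sqr_ge0// sqrtr_sqr.
Qed.

Let normr0_eq0 x : norm x = 0 -> x = 0.
Proof.
by move=> x0; apply: dot_eq0; rewrite -sqr_norm x0 expr0n.
Qed.

HB.instance Definition _ :=
  @Lmodule_isNormed.Build R V norm ler_normD normrZ normr0_eq0.

Let dot_norm x : dot x x = `|x| ^+ 2. Proof. by rewrite -sqr_norm. Qed.

HB.instance Definition _ :=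
  @isFinHilbert.Build R V dot dotC dotDl dotZl dot_norm.

HB.end.

Section subspace.
Context (R : realType) (E : hilbertType R) (U : {vspace E}).
Implicit Types u v w : subvs_of U.

Let sdot u v := '[vsval u, vsval v].

Let sdotC u v : sdot u v = sdot v u. Proof. exact: hdotC. Qed.

Let sdotDl u v w : sdot (u + v) w = sdot u w + sdot v w.
Proof. by rewrite /sdot linearD hdotDl. Qed.

Let sdotZl (a : R) u v : sdot (a *: u) v = a * sdot u v.
Proof. by rewrite /sdot linearZ hdotZl. Qed.

Let sdot_ge0 u : 0 <= sdot u u.
Proof. by rewrite /sdot hdot_norm sqr_ge0. Qed.

Let sdot_eq0 u : sdot u u = 0 -> u = 0.
Proof.
rewrite /sdot hdot_norm => /eqP; rewrite sqrf_eq0 normr_eq0 => /eqP u0.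
by apply: val_inj; rewrite /= u0.
Qed.

HB.instance Definition _ := Vector_isFinHilbert.Build R (subvs_of U)
  sdotC sdotDl sdotZl sdot_ge0 sdot_eq0.

End subspace.

(* An alias of the product type: [A * B] itself already carries the sup norm. *)
Definition hpair (R : realType) (A B : hilbertType R) : Type := (A * B)%type.

Section hpair.
Context (R : realType) (A B : hilbertType R).

HB.instance Definition _ := Vector.copy (hpair A B) (A * B)%type.

Implicit Types u v w : hpair A B.

Let pdot u v := '[u.1, v.1] + '[u.2, v.2].

Let pdotC u v : pdot u v = pdot v u.
Proof. by rewrite /pdot hdotC [X in _ + X]hdotC. Qed.

Let pdotDl u v w : pdot (u + v) w = pdot u w + pdot v w.
Proof. by rewrite /pdot !hdotDl addrACA. Qed.

Let pdotZl (a : R) u v : pdot (a *: u) v = a * pdot u v.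
Proof. by rewrite /pdot !hdotZl mulrDr. Qed.

Let pdot_ge0 u : 0 <= pdot u u.
Proof. by rewrite /pdot !hdot_norm addr_ge0 ?sqr_ge0. Qed.

Let pdot_eq0 u : pdot u u = 0 -> u = 0.
Proof.
rewrite /pdot !hdot_norm => /eqP; rewrite paddr_eq0 ?sqr_ge0// !sqrf_eq0.
by rewrite !normr_eq0; case: u => a b /= /andP[/eqP-> /eqP->].
Qed.

HB.instance Definition _ := Vector_isFinHilbert.Build R (hpair A B)
  pdotC pdotDl pdotZl pdot_ge0 pdot_eq0.

End hpair.

Definition hprod (R : realType) (n : nat) (E : 'I_n -> hilbertType R) : Type :=
  {dffun forall i, E i}.

Section hprod.
Import VectorInternalTheory.
Context (R : realType) (n : nat) (E : 'I_n -> hilbertType R).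

HB.instance Definition _ := Choice.copy (hprod E) {dffun forall i, E i}.
Implicit Types u v w : hprod E.

Let add u v : hprod E := [ffun i => u i + v i].
Let opp u : hprod E := [ffun i => - u i].
Let zero : hprod E := [ffun i => 0].
Let scale (a : R) u : hprod E := [ffun i => a *: u i].

Let addA : associative add.
Proof. by move=> u v w; apply/ffunP => i; rewrite !ffunE addrA. Qed.
Let addC : commutative add.
Proof. by move=> u v; apply/ffunP => i; rewrite !ffunE addrC. Qed.
Let add0 : left_id zero add.
Proof. by move=> u; apply/ffunP => i; rewrite !ffunE add0r. Qed.
Let addN : left_inverse zero opp add.
Proof. by move=> u; apply/ffunP => i; rewrite !ffunE addNr. Qed.

HB.instance Definition _ := GRing.isZmodule.Build (hprod E) addA addC add0 addN.

Let scaleA (a b : R) u : scale a (scale b u) = scale (a * b) u.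
Proof. by apply/ffunP => i; rewrite !ffunE scalerA. Qed.
Let scale1 : left_id 1 scale.
Proof. by move=> u; apply/ffunP => i; rewrite !ffunE scale1r. Qed.
Let scaleDr : right_distributive scale +%R.
Proof. by move=> a u v; apply/ffunP => i; rewrite !ffunE scalerDr. Qed.
Let scaleDl u : {morph scale^~ u : a b / a + b}.
Proof. by move=> a b; apply/ffunP => i; rewrite !ffunE scalerDl. Qed.

HB.instance Definition _ := GRing.Zmodule_isLmodule.Build R (hprod E)
  scaleA scale1 scaleDr scaleDl.

Lemma hprodDE u v i : (u + v) i = u i + v i. Proof. exact: ffunE. Qed.
Lemma hprodZE a u i : (a *: u) i = a *: u i. Proof. exact: ffunE. Qed.
Lemma hprod0E i : (0 : hprod E) i = 0. Proof. exact: ffunE. Qed.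

Let hprod_vect_iso : Vector.axiom (\sum_i dim (E i)) (hprod E).
Proof.
exists (fun u => \mxrow_i v2r (u i)).
  move=> a u v; apply/mxrowP => i.
  rewrite submxrowD !mxrowK hprodDE hprodZE linearP /=; congr (_ + _).
  apply/matrixP => j k.
  by rewrite !mxE -[in LHS](mxrowK (fun l => v2r (u l)) i) !mxE.
exists (fun r => [ffun i => r2v (submxrow r i)] : hprod E) => [u|r].
  by apply/ffunP => i; rewrite ffunE mxrowK v2rK.
by apply/mxrowP => i; rewrite mxrowK ffunE r2vK.
Qed.

HB.instance Definition _ := Lmodule_hasFinDim.Build R (hprod E) hprod_vect_iso.

Let bdot u v := \sum_i '[u i, v i].

Let bdotC u v : bdot u v = bdot v u.
Proof. by apply: eq_bigr => i _; rewrite hdotC. Qed.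

Let bdotDl u v w : bdot (u + v) w = bdot u w + bdot v w.
Proof. by rewrite -big_split; apply: eq_bigr => i _; rewrite hprodDE hdotDl. Qed.

Let bdotZl (a : R) u v : bdot (a *: u) v = a * bdot u v.
Proof. by rewrite mulr_sumr; apply: eq_bigr => i _; rewrite hprodZE hdotZl. Qed.

Let bdot_ge0 u : 0 <= bdot u u.
Proof. by apply: sumr_ge0 => i _; rewrite hdot_norm sqr_ge0. Qed.

Let bdot_eq0 u : bdot u u = 0 -> u = 0.
Proof.
move=> /eqP; rewrite psumr_eq0 => [|i _]; last by rewrite hdot_norm sqr_ge0.
move=> /allP u0; apply/ffunP => i; apply/eqP.
have := u0 i (mem_index_enum _).
by rewrite hdot_norm sqrf_eq0 normr_eq0 hprod0E.
Qed.

HB.instance Definition _ := Vector_isFinHilbert.Build R (hprod E)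
  bdotC bdotDl bdotZl bdot_ge0 bdot_eq0.

End hprod.

Section inner_product_theory.
Context (R : realType) (E : hilbertType R).
Implicit Types x y z : E.

Lemma hdotDr x y z : '[x, y + z] = '[x, y] + '[x, z].
Proof. by rewrite hdotC hdotDl !(hdotC x). Qed.

Lemma hdotZr (a : R) x y : '[x, a *: y] = a * '[x, y].
Proof. by rewrite hdotC hdotZl hdotC. Qed.

Lemma hdotBr x y z : '[x, y - z] = '[x, y] - '[x, z].
Proof. by rewrite hdotDr -scaleN1r hdotZr mulN1r. Qed.

Lemma hdotBl x y z : '[x - y, z] = '[x, z] - '[y, z].
Proof. by rewrite hdotC hdotBr !(hdotC z). Qed.

Lemma hdot0r x : '[x, 0] = 0.
Proof. by rewrite -(scale0r 0) hdotZr mul0r. Qed.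

Lemma hdot_eq0 x : '[x, x] = 0 -> x = 0.
Proof. by move=> /eqP; rewrite hdot_norm sqrf_eq0 normr_eq0 => /eqP. Qed.

Lemma hdot_inj x y : (forall z, '[z, x] = '[z, y]) -> x = y.
Proof.
move=> xy; apply/eqP; rewrite -subr_eq0; apply/eqP/hdot_eq0.
by rewrite hdotBr xy subrr.
Qed.

Lemma riesz (phi : {linear E -> R^o}) :
  exists g, forall x, phi x = '[x, g].
Proof.
have lin2 g : linear (fun x => '[x, g] : R^o).
  by move=> a u v; rewrite hdotDl hdotZl.
pose Lg g : 'Hom(E, R^o) := linfun (fun x => '[x, g] : R^o).
have LgE g x : Lg g x = '[x, g].
  pose m := GRing.isLinear.Build _ _ _ _ _ (lin2 g).
  pose h : {linear E -> R^o} := HB.pack (fun x => '[x, g] : R^o) m.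
  by rewrite -[RHS]/(h x) -(lfunE h).
have Llin : linear Lg.
  move=> a u v; apply/lfunP => x.
  by rewrite !lfunE /= !LgE lfunE /= LgE hdotDr hdotZr.
pose m := GRing.isLinear.Build _ _ _ _ _ Llin.
pose h : {linear E -> 'Hom(E, R^o)} := HB.pack Lg m.
have hE g x : linfun h g x = '[x, g] by rewrite (lfunE h) /= LgE.
have inj : (lker (linfun h) == 0)%VS.
  apply/lker0P => u v uv; apply: hdot_inj => x.
  by rewrite -!hE uv.
have full : limg (linfun h) = fullv.
  apply/eqP; rewrite eqEdim subvf limg_dim_eq ?(eqP inj) ?capv0//.
  by rewrite !dimvf /dim/= muln1.
have /memv_imgP[g _ eg] : linfun phi \in limg (linfun h) by rewrite full memvf.
by exists g => x; rewrite -hE -eg lfunE.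
Qed.

End inner_product_theory.

Section operators.
Context (R : realType).
Implicit Types E F : hilbertType R.

Definition adjoint E F (A : 'Hom(E, F)) : 'Hom(F, E) :=
  xget 0 [set B : 'Hom(F, E) | forall x y, '[A x, y] = '[x, B y]].

Lemma adjointP E F (A : 'Hom(E, F)) x y : '[A x, y] = '[x, adjoint A y].
Proof.
suff [B BP] : exists B : 'Hom(F, E), forall x y, '[A x, y] = '[x, B y].
  have := @xgetPex 'Hom(F, E) 0
    (fun B : 'Hom(F, E) => forall x y, '[A x, y] = '[x, B y]) (ex_intro _ B BP).
  exact.
have ex y0 : exists g, forall x, '[A x, y0] = '[x, g].
  have lin : linear (fun x => '[A x, y0] : R^o).
    by move=> a u v; rewrite linearP hdotDl hdotZl.
  pose m := GRing.isLinear.Build _ _ _ _ _ lin.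
  pose h : {linear E -> R^o} := HB.pack (fun x => '[A x, y0] : R^o) m.
  exact: riesz h.
have [g gP] := choice ex.
have lin : linear g.
  move=> a u v; apply: hdot_inj => z.
  by rewrite -gP hdotDr hdotZr !gP hdotDr hdotZr.
pose m := GRing.isLinear.Build _ _ _ _ _ lin.
pose h : {linear F -> E} := HB.pack g m.
by exists (linfun h) => u v; rewrite lfunE.
Qed.

Definition self_adjoint E (A : 'End(E)) := forall x y, '[A x, y] = '[x, A y].

Definition psd E (A : 'End(E)) := self_adjoint A /\ forall x, 0 <= '[x, A x].

Definition pd E (A : 'End(E)) :=
  self_adjoint A /\ forall x, x != 0 -> 0 < '[x, A x].

Definition opsqnorm E (A : 'End(E)) (x : E) : R := '[x, A x].

Definition is_pinv E F (A : 'Hom(E, F)) (B : 'Hom(F, E)) :=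
  [/\ (A \o B \o A = A)%VF, (B \o A \o B = B)%VF,
      self_adjoint (A \o B)%VF & self_adjoint (B \o A)%VF].

Definition pinv E F (A : 'Hom(E, F)) : 'Hom(F, E) := xget 0 (is_pinv A).

Definition mproj E (U : {vspace E}) (z : E) : subvs_of U :=
  xget 0 [set w : subvs_of U | forall w' : subvs_of U, `|z - vsval w| <= `|z - vsval w'|].

Let oproj E (U : {vspace E}) : 'End(E) :=
  let i : 'Hom(subvs_of U, E) := linfun vsval in (i \o adjoint i)%VF.

Let vsvalE E (U : {vspace E}) (w : subvs_of U) :
  linfun (vsval : subvs_of U -> E) w = vsval w.
Proof. by rewrite lfunE. Qed.

Let oprojP E (U : {vspace E}) z (w : E) : w \in U -> '[w, z - oproj U z] = 0.
Proof.
move=> wU; rewrite /oproj comp_lfunE vsvalE hdotBr.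
set i := linfun _.
have -> : '[w, vsval (adjoint i z)] = '[vsproj U w, adjoint i z].
  by rewrite {2}/hdot /= vsprojK.
by rewrite -adjointP vsvalE vsprojK// subrr.
Qed.

Let oproj_in E (U : {vspace E}) z : oproj U z \in U.
Proof. by rewrite /oproj comp_lfunE vsvalE; exact: subvsP. Qed.

Let oproj_id E (U : {vspace E}) z : z \in U -> oproj U z = z.
Proof.
move=> zU; apply/esym/eqP; rewrite -subr_eq0; apply/eqP/hdot_eq0.
by rewrite oprojP// rpredB// oproj_in.
Qed.

Let oproj_sa E (U : {vspace E}) : self_adjoint (oproj U).
Proof.
move=> x y; have := oprojP y (oproj_in U x); have := oprojP x (oproj_in U y).
rewrite !hdotBr => /eqP; rewrite subr_eq0 => /eqP e1 /eqP.
by rewrite subr_eq0 => /eqP ->; rewrite [RHS]hdotC e1 hdotC.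
Qed.

Lemma mprojP E (U : {vspace E}) z (w : E) :
  w \in U -> '[w, z - vsval (mproj U z)] = 0.
Proof.
have [w0 w0E] : exists w0 : subvs_of U, vsval w0 = oproj U z.
  by exists (vsproj U (oproj U z)); rewrite vsprojK ?oproj_in.
have key (v : subvs_of U) :
    `|z - vsval v| ^+ 2 = `|z - vsval w0| ^+ 2 + `|vsval w0 - vsval v| ^+ 2.
  have d0 : '[vsval w0 - vsval v, z - vsval w0] = 0.
    by rewrite w0E oprojP// rpredB ?oproj_in ?subvsP.
  rewrite -[z - vsval v](subrKA (vsval w0)) -!hdot_norm.
  move: (z - _) (_ - vsval v) d0 => a d d0.
  by rewrite hdotDl !hdotDr (hdotC a d) d0 addr0 add0r.
have w0P (w' : subvs_of U) : `|z - vsval w0| <= `|z - vsval w'|.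
  by rewrite -(@ler_pXn2r _ 2)// ?nnegrE// (key w') lerDl sqr_ge0.
have mP : forall w' : subvs_of U, `|z - vsval (mproj U z)| <= `|z - vsval w'|.
  exact: (@xgetPex (subvs_of U) 0 (fun v => forall w' : subvs_of U,
    `|z - vsval v| <= `|z - vsval w'|) (ex_intro _ w0 w0P)).
move=> wU.
have : `|z - vsval (mproj U z)| ^+ 2 <= `|z - vsval w0| ^+ 2.
  by rewrite ler_pXn2r// ?nnegrE//; exact: mP.
rewrite key gerDl => le0.
have /eqP : `|vsval w0 - vsval (mproj U z)| ^+ 2 = 0.
  by apply/le_anti; rewrite le0 sqr_ge0.
by rewrite sqrf_eq0 normr_eq0 subr_eq0 => /eqP <-; rewrite w0E oprojP.
Qed.

Lemma pinvP E F (A : 'Hom(E, F)) : is_pinv A (pinv A).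
Proof.
pose Q : 'End(E) := (\1 - oproj (lker A))%VF.
pose B : 'Hom(F, E) := (Q \o A^-1 \o oproj (limg A))%VF.
have QE x : Q x = x - oproj (lker A) x.
  by rewrite [LHS]add_lfunE opp_lfunE id_lfunE.
have AQ x : A (Q x) = A x.
  rewrite QE linearB/=.
  have /eqP -> : A (oproj (lker A) x) == 0 by rewrite -memv_ker oproj_in.
  by rewrite subr0.
have BE y : B y = Q ((A^-1)%VF (oproj (limg A) y)).
  by rewrite /B 2!comp_lfunE.
have AB : (A \o B = oproj (limg A))%VF.
  apply/lfunP => y; rewrite comp_lfunE BE AQ.
  by apply: limg_lfunVK; exact: oproj_in.
have BA : (B \o A = Q)%VF.
  apply/lfunP => x.
  rewrite comp_lfunE BE (oproj_id (memv_img _ (memvf _))).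
  apply/eqP; rewrite -subr_eq0 -linearB/= QE.
  rewrite subr_eq0 eq_sym; apply/eqP/oproj_id.
  by rewrite memv_ker linearB/= limg_lfunVK ?subrr// memv_img// memvf.
suff BP : is_pinv A B by exact: (xgetPex 0 (ex_intro _ B BP)).
split.
- apply/lfunP => x; rewrite AB comp_lfunE oproj_id//.
  by rewrite memv_img// memvf.
- rewrite BA; apply/lfunP => y; rewrite comp_lfunE BE.
  set u := (A^-1)%VF _; rewrite QE.
  apply/eqP; rewrite -subr_eq0 addrAC subrr add0r oppr_eq0.
  apply/eqP/hdot_inj => z; rewrite hdot0r -oproj_sa.
  by rewrite QE oprojP// oproj_in.
- by rewrite AB; exact: oproj_sa.
- by rewrite BA => x y; rewrite !QE hdotBl hdotBr oproj_sa.
Qed.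

End operators.

Section convex_analysis.
Context (R : realType).
Implicit Types E : hilbertType R.

Definition edom E (p : E -> \bar R) : set E := [set u | (p u < +oo)%E].

Definition proper_efun E (p : E -> \bar R) :=
  (forall u, p u != -oo%E) /\ edom p !=set0.

Definition convex_efun E (p : E -> \bar R) := forall (t : R) u w, 0 < t < 1 ->
  (p (t *: u + (1 - t) *: w)%R <= t%:E * p u + (1 - t)%:E * p w)%E.

Definition subdiff E (h : E -> \bar R) (x : E) : set E :=
  [set g | h x \is a fin_num /\ forall w, (h x + '[g, w - x]%:E <= h w)%E].

Definition grad E (f : E -> R) (x : E) : E :=
  xget 0 [set g : E | forall h, 'd f x h = '[g, h]].

Lemma gradP E (f : E -> R) x h : 'd f x h = '[grad f x, h].
Proof.
pose m := GRing.isLinear.Build R E R^o *:%R ('d f x) (linearP ('d f x)).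
pose l : {linear E -> R^o} := HB.pack ('d f x : E -> R^o) m.
have [g gP] := riesz l.
have := @xgetPex E 0 (fun g : E => forall h, 'd f x h = '[g, h]).
by apply; exists g => w; rewrite hdotC -gP.
Qed.

End convex_analysis.

Section blocks.
Context (R : realType) (n : nat) (E : 'I_n -> hilbertType R).

Definition hupd (y : hprod E) i (u : E i) : hprod E :=
  [ffun j => eqtype.dfwith y u j].

Definition hprj i : 'Hom(hprod E, E i) := linfun (fun y : hprod E => y i).
Definition hinj i : 'Hom(E i, hprod E) := linfun (fun u => hupd 0 u).

Lemma hprjE i y : hprj i y = y i.
Proof.
have lin : linear (fun y : hprod E => y i).
  by move=> a u v; rewrite hprodDE hprodZE.
pose m := GRing.isLinear.Build _ _ _ _ _ lin.
pose h : {linear hprod E -> E i} := HB.pack (fun y : hprod E => y i) m.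
by rewrite -[RHS]/(h y) -(lfunE h).
Qed.

Lemma hinjE i u : hinj i u = hupd 0 u.
Proof.
have lin : linear (fun u : E i => hupd 0 u).
  move=> a v w; apply/ffunP => j; rewrite hprodDE hprodZE !ffunE.
  case: (eqVneq i j) => [ij|ij]; first by case: _ / ij; rewrite !eqtype.dfwith_in.
  by rewrite !eqtype.dfwith_out// hprod0E scaler0 addr0.
pose m := GRing.isLinear.Build _ _ _ _ _ lin.
pose h : {linear E i -> hprod E} := HB.pack (fun u : E i => hupd 0 u) m.
by rewrite -[RHS]/(h u) -(lfunE h).
Qed.

(* (y_{<i}; u; y'_{>i}) *)
Definition splice (y y' : hprod E) i (u : E i) : hprod E :=
  [ffun j => eqtype.dfwith (fun j : 'I_n => if (j < i)%N then y j else y' j) u j].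

Definition blk (A : 'End(hprod E)) i j : 'Hom(E j, E i) :=
  (hprj i \o A \o hinj j)%VF.

Definition Diag (D : forall i, 'End(E i)) : 'End(hprod E) :=
  \sum_(i < n) (hinj i \o D i \o hprj i)%VF.

Definition blkdiag (A : 'End(hprod E)) : 'End(hprod E) :=
  \sum_(i < n) (hinj i \o blk A i i \o hprj i)%VF.

Definition blkupper (A : 'End(hprod E)) : 'End(hprod E) :=
  \sum_(i < n) \sum_(j < n | (i < j)%N) (hinj i \o blk A i j \o hprj j)%VF.

End blocks.

Arguments hprj {R n E} i.
Arguments hinj {R n E} i.
Arguments splice {R n E} y y' i u.

Section problem.
Context (R : realType) (s : nat).
Context (X Z : hilbertType R) (Y : 'I_s.+1 -> hilbertType R).
Context (p : Y ord0 -> \bar R) (f : hprod Y -> R).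
Context (F : 'Hom(X, hprod Y)) (G : 'Hom(X, Z)) (b : Z) (c : X).
Context (Sigma : 'End(hprod Y)) (sigma tau : R) (D : forall i, 'End(Y i)).

Definition kkt (x : X) (y : hprod Y) (z : Z) :=
  [/\ exists2 u, subdiff p (y ord0) u & 0 = hinj ord0 u + grad f y + F x,
      G x - b = 0 & adjoint F y + adjoint G z = c].

Definition fhat (y y' : hprod Y) : R :=
  f y' + '[grad f y', y - y'] + 2^-1 * opsqnorm Sigma (y - y').

Definition residual (y : hprod Y) (z : Z) : X :=
  adjoint F y + adjoint G z - c.

Definition Lag (y : hprod Y) (z : Z) (x : X) (y' : hprod Y) : \bar R :=
  (p (y ord0) + (fhat y y' - '[b, z] + '[residual y z, x]
                 + sigma / 2 * `|residual y z| ^+ 2)%:E)%E.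

(* In Step 1 the block [yh k ord0] of the half-step is unused, as is
   [dt k ord0]. *)
Section iteration.
Context (eps : nat -> R).
Context (x : nat -> X) (y yh : nat -> hprod Y) (z : nat -> Z).
Context (dt d : nat -> hprod Y).

Definition gamma_at (x0 : X) (y1 : hprod Y) (z1 : Z) : Z :=
  G x0 - b + sigma *: G (residual y1 z1).

Definition gamma k : Z := gamma_at (x k) (y k.+1) (z k.+1).

Record sGS_iPADMM : Prop := {
  init_dom : edom p (y 0%N ord0) ;
  half_err : forall k (i : 'I_s.+1), (0 < i)%N -> `|dt k i| <= eps k ;
  half_step : forall k (i : 'I_s.+1), (0 < i)%N ->
    [set g + D i (yh k i - y k i) | g in
       subdiff (fun u => Lag (splice (y k) (yh k) i u) (z k) (x k) (y k))
               (yh k i)] (dt k i) ;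
  full_err : forall k i, `|d k i| <= eps k ;
  full_step : forall k i,
    [set g + D i (y k.+1 i - y k i) | g in
       subdiff (fun u => Lag (splice (y k.+1) (yh k) i u) (z k) (x k) (y k))
               (y k.+1 i)] (d k i) ;
  z_step : forall k, `|gamma k| <= eps k ;
  x_step : forall k,
    x k.+1 = x k + (tau * sigma) *: residual (y k.+1) (z k.+1)
}.

Definition calN : 'End(hprod Y) :=
  Sigma + sigma *: (F \o adjoint F)%VF + Diag D.
Definition calNd : 'End(hprod Y) := blkdiag calN.
Definition calNu : 'End(hprod Y) := blkupper calN.
Definition calNsGS : 'End(hprod Y) := (calNu \o calNd^-1 \o adjoint calNu)%VF.

Definition dtilde k : hprod Y := hupd (dt k) (d k ord0).

Definition dsGS k : hprod Y := d k + calNu ((calNd^-1)%VF (d k - dtilde k)).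

(* x^{k-1} and gamma^{k-1}, with the convention for x^{-1} and gamma^{-1} *)
Definition x_prev k : X :=
  if k is k'.+1 then x k' else x 0%N - (tau * sigma) *: residual (y 0%N) (z 0%N).
Definition gamma_prev k : Z := gamma_at (x_prev k) (y k) (z k).

Definition Delta k : hprod Y :=
  dsGS k - F (adjoint G (pinv (G \o adjoint G)%VF
    (gamma_prev k - gamma k - G (x_prev k - x k)))).

Definition calV : hilbertType R := hpair (hprod Y) (subvs_of (limg G)).

(* Faithful only for [z] in the range of [G], where [vsproj] is exact. *)
Definition inV (y0 : hprod Y) (z0 : Z) : calV := (y0, vsproj (limg G) z0).

Definition vseq k : calV := (y k, mproj (limg G) (z k)).

Definition actY (A : 'End(hprod Y)) : 'End(calV) :=
  linfun (fun v : calV => (A v.1, 0) : calV).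

Lemma actYE A v : actY A v = (A v.1, 0) :> calV.
Proof.
have lin : linear (fun v : calV => (A v.1, 0) : calV).
  move=> a u w; transitivity ((a *: A u.1 + A w.1, a *: 0 + 0) : calV) => //.
  by rewrite scaler0 addr0 -linearP.
pose m := GRing.isLinear.Build _ _ _ _ _ lin.
pose h : {linear calV -> calV} := HB.pack (fun v : calV => (A v.1, 0) : calV) m.
by rewrite -[RHS]/(h v) -(lfunE h).
Qed.

Definition calT : 'End(calV) := actY (Diag D + calNsGS + sigma *:
  (F \o adjoint G \o pinv (G \o adjoint G) \o G \o adjoint F)%VF).

Definition calP : 'End(calV) := actY Sigma.

Definition calB : 'Hom(X, calV) := linfun (fun x0 => inV (F x0) (G x0)).

Lemma calBE x0 : calB x0 = inV (F x0) (G x0).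
Proof.
have lin : linear (fun x0 => inV (F x0) (G x0)).
  by move=> a u w; rewrite /inV !linearP.
pose m := GRing.isLinear.Build _ _ _ _ _ lin.
pose h : {linear X -> calV} := HB.pack (fun x0 => inV (F x0) (G x0)) m.
by rewrite -[RHS]/(h x0) -(lfunE h).
Qed.

Definition LagV (v : calV) (x0 : X) (v' : calV) : \bar R :=
  Lag v.1 (vsval v.2) x0 v'.1.

End iteration.
End problem.

Arguments LagV {R s X Z Y} p f F G b c Sigma sigma v x0 v'.

(* Main.v *)
Require Import Defs.
From HB Require Import structures.
From mathcomp Require Import all_boot all_order all_algebra.
From mathcomp Require Import all_classical all_reals all_analysis.
From mathcomp Require Import ring lra.

Import Order.TTheory GRing.Theory Num.Theory.
Import numFieldNormedType.Exports.

Local Open Scope classical_set_scope.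
Local Open Scope ring_scope.

(** Everything comes from one identity: a backward block sweep followed by a
    forward one, each solved inexactly, amounts to one inexact proximal step on
    the whole vector [y], with the extra proximal operator
    N_sGS = N_u N_d^-1 N_u^*.

    Optimality.  In block [i], the smooth part of the majorized augmented
    Lagrangian at the current iterate is quadratic, and its gradient is a
    constant plus the [i]-th row of N (including the proximal term D_i) applied
    to the displacement.  The half-steps use the rows of N_d + N_u, the full
    steps those of N_d + N_u^* on the new displacement and of N_u on the
    half-step one.  Subtracting expresses the half-step displacement through the
    final one, and substituting it back leaves N + N_sGS on the final
    displacement ([sGS_identity]).  The nonsmooth term enters only through the
    first block, where convexity of [p] allows the gradient of the quadratic to
    be moved out of the subdifferential ([subdiff_sub_smooth]).  The sweep used
    the old [z], whereas the joint problem needs the new one; the discrepancy is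
    sigma F G^*(z^k - z^{k+1}).  Let Q be the orthogonal projection onto the
    range of G^*, that is G^* composed with the pseudoinverse of G G^* and with
    G ([rproj]), and let r_k be the primal residual.  Since Q fixes G^* z, the
    discrepancy is sigma F Q (r_k - r_{k+1}), the correction in Delta^k, plus
    sigma F Q F^*(y^{k+1} - y^k), which is exactly what the operator T adds
    ([DeltaE]).  The joint subproblem being convex, this stationarity is the
    claimed inclusion ([LagV_subdiff]).

    Summability.  With h_k = G x^k - b, the multiplier update reads
    h_{k+1} = (1 - tau) h_k + tau gamma^k, a contraction since 0 < tau < 2, with
    summable perturbation; so |h_k| is summable.  The correction in Delta^k is
    a fixed linear map applied to the difference of sigma G r_k and
    sigma G r_{k+1}, and sigma G r_{k+1} = gamma^k - h_k.

    Positivity.  The quadratic form of P/2 + sigma B B^* + T is a sum of four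
    nonnegative terms.  If all vanish, applying Q to F^* y + G^* z = 0 kills
    [z]; then F^* y = 0, (D + Sigma/2) y = 0 and N_u^* y = 0.  This forces y = 0,
    by looking at its last nonzero block ([sGS_kernel]). *)

Set Implicit Arguments.
Unset Strict Implicit.
Unset Printing Implicit Defensive.

(** * Finite-dimensional Hilbert spaces *)

Section hilbert.
Context {R : realType}.
Implicit Types E H K : hilbertType R.

Lemma lfunD E H (A : 'Hom(E, H)) x y : A (x + y) = A x + A y.
Proof. exact: linearD. Qed.

Lemma lfunB E H (A : 'Hom(E, H)) x y : A (x - y) = A x - A y.
Proof. exact: linearB. Qed.

Lemma lfunN E H (A : 'Hom(E, H)) x : A (- x) = - A x.
Proof. exact: linearN. Qed.

Lemma lfunZ E H (A : 'Hom(E, H)) (a : R) x : A (a *: x) = a *: A x.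
Proof. exact: linearZ. Qed.

Lemma hdotNl E (x y : E) : '[- x, y] = - '[x, y].
Proof. by rewrite -scaleN1r hdotZl mulN1r. Qed.

Lemma hdotNr E (x y : E) : '[x, - y] = - '[x, y].
Proof. by rewrite hdotC hdotNl hdotC. Qed.

Lemma hdot0l E (x : E) : '[0, x] = 0.
Proof. by rewrite hdotC hdot0r. Qed.

Lemma hdot_ge0 E (x : E) : 0 <= '[x, x].
Proof. by rewrite hdot_norm sqr_ge0. Qed.

Lemma hdot_Cauchy_Schwarz E (x y : E) : '[x, y] <= `|x| * `|y|.
Proof.
have [->|x0] := eqVneq x 0; first by rewrite hdot0l normr0 mul0r.
have [->|y0] := eqVneq y 0; first by rewrite hdot0r normr0 mulr0.
have nx : 0 < `|x| by rewrite normr_gt0.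
have ny : 0 < `|y| by rewrite normr_gt0.
have := hdot_ge0 (`|y| *: x - `|x| *: y).
rewrite hdotBl !hdotBr !hdotZl !hdotZr !hdot_norm (hdotC y x).
have -> : `|y| * (`|y| * `|x| ^+ 2) - `|y| * (`|x| * '[x, y]) -
  (`|x| * (`|y| * '[x, y]) - `|x| * (`|x| * `|y| ^+ 2)) =
  (2 * (`|x| * `|y|)) * (`|x| * `|y| - '[x, y]) by ring.
by rewrite pmulr_rge0 ?subr_ge0// !mulr_gt0.
Qed.

Lemma adjointPr E H (A : 'Hom(E, H)) x y : '[adjoint A y, x] = '[y, A x].
Proof. by rewrite hdotC -adjointP hdotC. Qed.

(** Finite dimension enters here: each coordinate on a basis is an inner product,
    by Riesz, hence bounded by Cauchy-Schwarz. *)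
Lemma lfun_bounded E H (A : 'Hom(E, H)) :
  exists2 M : R, 0 <= M & forall x, `|A x| <= M * `|x|.
Proof.
pose e := vbasis (fullv : {vspace E}).
have ex i : exists g, forall x, coord e i x = '[x, g].
  pose m := GRing.isLinear.Build _ _ _ _ _ (linearP (coord e i)).
  pose l : {linear E -> R^o} := HB.pack (coord e i : E -> R^o) m.
  exact: riesz l.
have [g gP] := choice ex.
exists (\sum_i `|g i| * `|A e`_i|) => [|x].
  by apply: sumr_ge0 => i _; rewrite mulr_ge0.
rewrite {1}(coord_vbasis (memvf x)) linear_sum mulr_suml.
apply: (le_trans (ler_norm_sum _ _ _)); apply: ler_sum => i _.
rewrite linearZ/= normrZ mulrAC ler_wpM2r// gP.
rewrite ler_norml mulrC hdot_Cauchy_Schwarz andbT lerNl -hdotNl.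
by rewrite (le_trans (hdot_Cauchy_Schwarz _ _))// normrN.
Qed.

(** The form is nonnegative along the whole line through [x] directed by [A x];
    its derivative at [x], proportional to [|A x|^2], must then vanish. *)
Lemma psd_ker E (A : 'End(E)) x : psd A -> '[x, A x] = 0 -> A x = 0.
Proof.
move=> [sA pA] xAx; apply: hdot_eq0.
set a := '[A x, A x]; pose q := '[A x, A (A x)].
have q0 : 0 <= q by exact: pA.
have a0 : 0 <= a by exact: hdot_ge0.
(* the point [x - t A x] with [t = a / (q + 1)], cleared of its denominator *)
have := pA ((q + 1) *: x - a *: A x).
rewrite lfunB !lfunZ hdotBl !hdotBr !hdotZl !hdotZr xAx -/q -/a.
rewrite -(sA x) -/a => le0.
nra.
Qed.

Lemma psd_add E (A B : 'End(E)) : psd A -> psd B -> psd (A + B).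
Proof.
move=> [sA pA] [sB pB]; split=> [x y|x]; rewrite !add_lfunE.
  by rewrite hdotDl hdotDr sA sB.
by rewrite hdotDr addr_ge0.
Qed.

Lemma psd_scale E (a : R) (A : 'End(E)) : 0 <= a -> psd A -> psd (a *: A).
Proof.
move=> a0 [sA pA]; split=> [x y|x]; rewrite !scale_lfunE.
  by rewrite hdotZl hdotZr sA.
by rewrite hdotZr mulr_ge0.
Qed.

Lemma psd_congr E H (A : 'End(E)) (B : 'Hom(E, H)) :
  psd A -> psd (B \o A \o adjoint B)%VF.
Proof.
move=> [sA pA]; split=> [x y|x]; rewrite !comp_lfunE.
  by rewrite adjointP sA adjointPr.
by rewrite -adjointPr pA.
Qed.

Lemma pd_psd E (A : 'End(E)) : pd A -> psd A.
Proof.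
move=> [sA pA]; split=> // x; have [->|x0] := eqVneq x 0.
  by rewrite hdot0l.
exact/ltW/pA.
Qed.

(** [A^-1] is in general only a right inverse on the range of [A]; definiteness makes
    [A] injective, and finite dimension does the rest. *)
Lemma pd_invK E (A : 'End(E)) : pd A -> cancel A (A^-1)%VF * cancel (A^-1)%VF A.
Proof.
move=> [_ pA].
have k0 : lker A == 0%VS.
  apply/lker0P => u v uv; apply/eqP; rewrite -subr_eq0; apply/negP => /negP.
  by move=> /pA; rewrite linearB/= uv subrr hdot0r ltxx.
split=> x; first by rewrite (lker0_lfunK k0).
by rewrite -comp_lfunE lker0_compfV// id_lfunE.
Qed.

Lemma pd_inv E (A : 'End(E)) : pd A -> pd (A^-1)%VF.
Proof.
move=> pdA; have [AK VK] := pd_invK pdA; case: pdA => [sA pA]; split=> [x y|x x0].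
  by rewrite -{2}(VK x) sA VK.
rewrite -{1}(VK x) sA pA//.
by apply: contra_neq x0 => x0; rewrite -(VK x) x0 linear0.
Qed.

End hilbert.

(** * The orthogonal projection onto the range of G^* *)

Section range_projection.
Context {R : realType} (X Z : hilbertType R) (G : 'Hom(X, Z)).

(** The orthogonal projection onto the range of [adjoint G]: it is idempotent and
    self-adjoint ([rproj_dot], [rproj_psd]) and fixes that range
    ([rproj_adjoint]). *)
Definition rproj : 'End(X) :=
  (adjoint G \o Defs.pinv (G \o adjoint G) \o G)%VF.

(** The product of [G G^*] with its pseudoinverse is the projection onto the range
    of [G G^*], which is that of [G]; the equality of the two ranges is obtained from
    [|G^* u|^2 = <u, G G^* u>]. *)
Lemma pinv_range x : G (adjoint G (Defs.pinv (G \o adjoint G)%VF (G x))) = G x.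
Proof.
set A := (G \o adjoint G)%VF; set B := Defs.pinv A.
have [ABA _ sAB _] := Defs.pinvP A; rewrite -/B in ABA sAB.
have AE u : A u = G (adjoint G u) by rewrite comp_lfunE.
have sA u w : '[A u, w] = '[u, A w] by rewrite !AE adjointP adjointPr.
have ABAE u : A (B (A u)) = A u.
  by have /lfunP/(_ u) := ABA; rewrite 2!comp_lfunE.
have sABE u w : '[A (B u), w] = '[u, A (B w)].
  by have := sAB u w; rewrite !comp_lfunE.
(* [A] and [A B] are self-adjoint, so A B A = A transposes to A A B = A *)
have AAB u : A (A (B u)) = A u.
  by apply: hdot_inj => w; rewrite -sA -sABE ABAE sA.
have GAB u : adjoint G (A (B u) - u) = 0.
  by apply: hdot_eq0; rewrite -adjointP -AE lfunB AAB subrr hdot0l.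
rewrite -AE; apply: hdot_inj => w; apply/eqP.
by rewrite hdotC sABE [X in _ == X]hdotC -subr_eq0 -hdotBr adjointP GAB hdot0r.
Qed.

Lemma rprojE x : rproj x = adjoint G (Defs.pinv (G \o adjoint G)%VF (G x)).
Proof. by rewrite !comp_lfunE. Qed.

Lemma rproj_dot x w : '[rproj x, rproj w] = '[rproj x, w].
Proof.
by rewrite !rprojE (adjointPr _ w) adjointPr pinv_range.
Qed.

Lemma rproj_adjoint u : rproj (adjoint G u) = adjoint G u.
Proof.
apply/eqP; rewrite -subr_eq0; apply/eqP/hdot_eq0.
have Gr : G (rproj (adjoint G u) - adjoint G u) = 0.
  by rewrite linearB/= rprojE pinv_range subrr.
have eQ : rproj (adjoint G u) - adjoint G u =
  adjoint G (Defs.pinv (G \o adjoint G)%VF (G (adjoint G u)) - u).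
  by rewrite rprojE -linearB.
by rewrite {1}eQ adjointPr Gr hdot0r.
Qed.

Lemma rproj_psd : psd rproj.
Proof.
split=> [x y|x]; last by rewrite hdotC -rproj_dot hdot_ge0.
by rewrite -rproj_dot hdotC rproj_dot hdotC.
Qed.

End range_projection.

(** * Block vectors and the triangular splitting of an operator *)

Section block_vectors.
Context {R : realType} {n : nat} {Y : 'I_n -> hilbertType R}.
Implicit Types (u v y : hprod Y) (A : 'End(hprod Y)).

(** Cutting a vector to some of its blocks turns a row of a triangular part of an
    operator into a row of the operator itself ([blkupperE],
    [adjoint_blkupperE]), so that no sum over blocks has to be manipulated. *)
Definition hcut (P : pred 'I_n) y : hprod Y :=
  [ffun i => if P i then y i else 0].

Lemma hcutE P y i : hcut P y i = if P i then y i else 0.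
Proof. exact: ffunE. Qed.

Lemma hprodP u v : (forall i, u i = v i) -> u = v.
Proof. by move=> uv; apply/ffunP. Qed.

Lemma hprodBE u v i : (u - v) i = u i - v i.
Proof. by rewrite -scaleN1r hprodDE hprodZE scaleN1r. Qed.

Lemma hprod_sumE I (r : seq I) (P : pred I) (u : I -> hprod Y) i :
  (\sum_(k <- r | P k) u k) i = \sum_(k <- r | P k) u k i.
Proof.
by elim/big_rec2: _ => [|k a b _ <-]; rewrite ?hprod0E ?hprodDE.
Qed.

Lemma hinj_in i (u : Y i) : hinj i u i = u.
Proof. by rewrite hinjE ffunE eqtype.dfwith_in. Qed.

Lemma hinj_out i j (u : Y i) : i != j -> hinj i u j = 0.
Proof. by move=> ij; rewrite hinjE ffunE eqtype.dfwith_out// hprod0E. Qed.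

Lemma hdot_hprod u v : '[u, v] = \sum_i '[u i, v i].
Proof. by []. Qed.

Lemma hdot_hinj i (u : Y i) y : '[hinj i u, y] = '[u, y i].
Proof.
rewrite hdot_hprod (bigD1 i)//= hinj_in big1 ?addr0// => j ij.
by rewrite hinj_out ?hdot0l// eq_sym.
Qed.

Lemma hdot_hcut P u y : '[u, hcut P y] = \sum_(i | P i) '[u i, y i].
Proof.
rewrite hdot_hprod [RHS]big_mkcond/=; apply: eq_bigr => i _.
by rewrite hcutE; case: ifP => // _; rewrite hdot0r.
Qed.

Lemma hcut_sum P y : hcut P y = \sum_(i | P i) hinj i (y i).
Proof.
apply: hprodP => j; rewrite hcutE hprod_sumE; case: ifP => Pj.
  rewrite (bigD1 j)//= hinj_in big1 ?addr0// => i /andP[_ ij].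
  by rewrite hinj_out.
by rewrite big1// => i Pi; rewrite hinj_out//; apply: contraFN Pj => /eqP <-.
Qed.

Lemma hcut_hinj P i (u : Y i) : hcut P (hinj i u) = if P i then hinj i u else 0.
Proof.
apply: hprodP => j; rewrite hcutE; have [<-|ij] := eqVneq i j.
  by case: ifP; rewrite ?hprod0E.
by rewrite hinj_out//; case: ifP; case: ifP; rewrite ?hinj_out ?hprod0E.
Qed.

Lemma hcut_split (i : 'I_n) y :
  y = hinj i (y i) + hcut (fun j : 'I_n => i < j)%N y
                   + hcut (fun j : 'I_n => j < i)%N y.
Proof.
apply: hprodP => j; rewrite !hprodDE !hcutE; case: (ltngtP i j) => ij.
- by rewrite hinj_out ?add0r ?addr0// -val_eqE/= ltn_eqF.
- by rewrite hinj_out ?add0r ?addr0// -val_eqE/= gtn_eqF.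
- by move/val_inj: ij => <-; rewrite hinj_in !addr0.
Qed.

Lemma hcut_le (i : 'I_n) y :
  hcut (fun j : 'I_n => j <= i)%N y = hinj i (y i) + hcut (fun j : 'I_n => j < i)%N y.
Proof.
apply: hprodP => j; rewrite hprodDE !hcutE; case: (ltngtP i j) => ij.
- by rewrite hinj_out ?addr0// -val_eqE/= ltn_eqF.
- by rewrite hinj_out ?add0r// -val_eqE/= gtn_eqF.
- by move/val_inj: ij => <-; rewrite hinj_in !addr0.
Qed.

Lemma hcut_ge (i : 'I_n) y :
  hcut (fun j : 'I_n => i <= j)%N y = hinj i (y i) + hcut (fun j : 'I_n => i < j)%N y.
Proof.
apply: hprodP => j; rewrite hprodDE !hcutE; case: (ltngtP i j) => ij.
- by rewrite hinj_out ?add0r// -val_eqE/= ltn_eqF.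
- by rewrite hinj_out ?addr0// -val_eqE/= gtn_eqF.
- by move/val_inj: ij => <-; rewrite hinj_in !addr0.
Qed.

Lemma blkE A i j (u : Y j) : blk A i j u = A (hinj j u) i.
Proof. by rewrite 2!comp_lfunE hprjE. Qed.

Lemma DiagE (D : forall i, 'End(Y i)) y i : Diag D y i = D i (y i).
Proof.
rewrite sum_lfunE hprod_sumE (bigD1 i)//= !comp_lfunE hprjE hinj_in.
by rewrite big1 ?addr0// => j ij; rewrite !comp_lfunE hinj_out.
Qed.

Lemma blkdiagE A y i : blkdiag A y i = A (hinj i (y i)) i.
Proof. by rewrite [blkdiag A]/(Diag (fun i => blk A i i)) DiagE blkE. Qed.

Lemma blkupperE A y i : blkupper A y i = A (hcut (fun j : 'I_n => i < j)%N y) i.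
Proof.
rewrite sum_lfunE hprod_sumE (bigD1 i)//= [X in _ + X]big1 ?addr0; last first.
  move=> j ij; rewrite sum_lfunE hprod_sumE big1// => k _.
  by rewrite !comp_lfunE hinj_out.
rewrite sum_lfunE hprod_sumE hcut_sum linear_sum hprod_sumE.
by apply: eq_bigr => k ik; rewrite 2!comp_lfunE hinj_in blkE hprjE.
Qed.

Lemma adjoint_blkupperE A y i : self_adjoint A ->
  adjoint (blkupper A) y i = A (hcut (fun j : 'I_n => j < i)%N y) i.
Proof.
move=> sA; apply: hdot_inj => u; rewrite -!hdot_hinj -adjointP -sA hdot_hcut.
rewrite hdot_hprod [RHS]big_mkcond/=; apply: eq_bigr => k _.
rewrite blkupperE hcut_hinj; case: ifP => // _.
by rewrite linear0 hprod0E hdot0l.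
Qed.

Lemma block_splitting A y : self_adjoint A ->
  A y = blkdiag A y + blkupper A y + adjoint (blkupper A) y.
Proof.
move=> sA; apply: hprodP => i; rewrite {1}(hcut_split i y) !lfunD !hprodDE.
by rewrite blkdiagE blkupperE adjoint_blkupperE.
Qed.

Lemma blkdiag_pd A : self_adjoint A -> (forall i, pd (blk A i i)) -> pd (blkdiag A).
Proof.
move=> sA pA; split=> [x y|x x0].
  rewrite !hdot_hprod; apply: eq_bigr => i _; rewrite !blkdiagE.
  by have [+ _] := pA i; move=> /(_ (x i) (y i)); rewrite !blkE.
rewrite lt_neqAle eq_sym; apply/andP; split; last first.
  rewrite hdot_hprod; apply: sumr_ge0 => i _; rewrite blkdiagE -blkE.
  by have [_] := pd_psd (pA i); exact.
apply: contra_neq x0 => /eqP; rewrite hdot_hprod psumr_eq0 => [/allP x0|i _].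
  apply: hprodP => i; rewrite hprod0E; apply/eqP; apply: contraTT isT => xi.
  have := x0 i (mem_index_enum _); rewrite blkdiagE -blkE/=.
  by have [_ /(_ _ xi)] := pA i; rewrite lt_def => /andP[/negbTE->].
by rewrite blkdiagE -blkE; have [_] := pd_psd (pA i); exact.
Qed.

Lemma splice_in y y' i (u : Y i) : splice y y' i u i = u.
Proof. by rewrite ffunE eqtype.dfwith_in. Qed.

Lemma splice_lt y y' i (u : Y i) (j : 'I_n) : (j < i)%N -> splice y y' i u j = y j.
Proof.
by move=> ji; rewrite ffunE eqtype.dfwith_out ?ji// -val_eqE/= gtn_eqF.
Qed.

Lemma splice_gt y y' i (u : Y i) (j : 'I_n) : (i < j)%N -> splice y y' i u j = y' j.
Proof.
move=> ij; rewrite ffunE eqtype.dfwith_out ?ltnNge ?(ltnW ij)//.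
by rewrite -val_eqE/= ltn_eqF.
Qed.

Lemma splice_shift y y' i (u w : Y i) :
  splice y y' i w = splice y y' i u + hinj i (w - u).
Proof.
apply: hprodP => j; rewrite hprodDE; case: (ltngtP i j) => ij.
- by rewrite !splice_gt// hinj_out ?addr0// -val_eqE/= ltn_eqF.
- by rewrite !splice_lt// hinj_out ?addr0// -val_eqE/= gtn_eqF.
- by move/val_inj: ij => <-; rewrite !splice_in hinj_in addrC subrK.
Qed.

Lemma splice_sub y0 y y' i : splice y y' i (y i) - y0 =
  hcut (fun j : 'I_n => j <= i)%N (y - y0) + hcut (fun j : 'I_n => i < j)%N (y' - y0).
Proof.
apply: hprodP => j; rewrite hprodBE hprodDE !hcutE !hprodBE.
case: (ltngtP i j) => ij; rewrite ?addr0 ?add0r.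
- by rewrite splice_gt.
- by rewrite splice_lt.
- by move/val_inj: ij => <-; rewrite splice_in.
Qed.

Lemma splice_sub_ge y y' i :
  splice y y' i (y' i) - y = hcut (fun j : 'I_n => i <= j)%N (y' - y).
Proof.
apply: hprodP => j; rewrite hprodBE !hcutE !hprodBE.
case: (ltngtP i j) => ij.
- by rewrite splice_gt.
- by rewrite splice_lt// subrr.
- by move/val_inj: ij => <-; rewrite splice_in.
Qed.

End block_vectors.

(** * Subdifferential of a convex function plus a quadratic *)

Section convexity.
Context {R : realType} {E : hilbertType R}.
Implicit Types (P : E -> \bar R) (q r : E -> R) (x g m : E).

Lemma convex_efun_cst (a : \bar R) : a \is a fin_num ->
  convex_efun (fun=> a : \bar R) (E := E).
Proof.
move=> /fineK <- t u w _.
by rewrite -!EFinM -EFinD lee_fin -mulrDl addrC subrK mul1r.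
Qed.

Lemma subdiff_cst (a : \bar R) x g : subdiff (fun=> a) x g -> g = 0.
Proof.
move=> [/fineK <- /(_ (x + g))]; rewrite addrAC subrr add0r -EFinD lee_fin gerDl => g0.
by apply/hdot_eq0/le_anti; rewrite g0 hdot_ge0.
Qed.

(** Along the segment from [x] to [w], convexity makes [P] grow at most linearly
    in the parameter [t], whereas the remainder [r] of [q] is of order [t^2]:
    dividing by [t] and letting it tend to [0] leaves the subgradient inequality of [P].
    Convexity of [P] is essential here, as [g] is a global subgradient of the sum
    only. *)
Lemma subdiff_sub_smooth P q r x g m : convex_efun P ->
  (forall h, q (x + h) = q x + '[m, h] + r h) ->
  (forall t h, r (t *: h) = t ^+ 2 * r h) ->
  subdiff (fun u => (P u + (q u)%:E)%E) x g -> subdiff P x (g - m).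
Proof.
move=> cP qE rE [fx gP].
have Px : P x \is a fin_num by move: fx; rewrite fin_numD => /andP[].
split=> // w; have [->|wx] := eqVneq w x.
  by rewrite subrr hdot0r adde0.
have seg t : x + t *: (w - x) = t *: w + (1 - t) *: x.
  by rewrite scalerBr scalerBl scale1r addrCA addrC -addrA [- _ + _]addrC.
have key (t : R) : 0 < t < 1 ->
  (P x + (t * '[g - m, w - x] - t ^+ 2 * r (w - x))%:E <=
   t%:E * P w + (1 - t)%:E * P x)%E.
  move=> t01; have := cP t w x t01; rewrite -seg; apply: le_trans.
  have := gP (x + t *: (w - x)).
  rewrite [x + _ - x]addrAC subrr add0r qE rE !hdotZr hdotBl -(fineK Px).
  case: (P (x + _)) => [a| |]//=; rewrite ?leey// -?EFinD ?lee_fin//.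
  lra.
move: key; rewrite -(fineK Px); case: (P w) => [a| |] key; last 2 first.
- exact: leey.
- have := key 2^-1; rewrite gt0_muleNy ?lte_fin ?invr_gt0// => /(_ _).
  by rewrite -EFinM -EFinD/= => /(_ _)/negP; case; rewrite ?invr_gt0//; lra.
rewrite -EFinD lee_fin leNgt; apply/negP => lt_a.
set px := fine (P x) in key lt_a; set v := '[_, _] in key lt_a.
set rr := r _ in key.
(* a gap [e > 0] at first order would be at most [t r] for every [t] in ]0, 1[;
   this [t] makes [t |r| < e] *)
pose e := px + v - a; have e0 : 0 < e by rewrite subr_gt0.
have n0 : 0 <= `|rr| by [].
have s0 : 0 < e + `|rr| + 1 by lra.
pose t := e / (e + `|rr| + 1).
have t0 : 0 < t by rewrite divr_gt0.
have ts : t * (e + `|rr| + 1) = e by rewrite divfK// gt_eqF.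
have t1 : t < 1 by rewrite ltr_pdivrMr// mul1r; lra.
have := key t; rewrite t0 t1 => /(_ isT).
rewrite -!EFinM -!EFinD lee_fin => le_t.
have : t * e <= t * (t * rr) by rewrite /e; nra.
rewrite ler_pM2l//; have := ler_norm rr; nra.
Qed.

Lemma subdiff_add_smooth P q x g m : subdiff P x g ->
  (forall w, q x + '[m, w - x] <= q w) ->
  subdiff (fun u => (P u + (q u)%:E)%E) x (g + m).
Proof.
move=> [Px gP] qP; split=> [|w]; first by rewrite fin_numD Px.
rewrite hdotDl.
apply: (@le_trans _ _ ((P x + '[g, w - x]%:E) + (q x + '[m, w - x])%:E)%E).
  rewrite -(fineK Px) -!EFinD lee_fin; lra.
by apply: leeD; rewrite ?lee_fin.
Qed.

End convexity.

(** * Perturbed contractions *)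

Section summable_sequences.
Context {R : realType}.

(** The partial sums [S n] of [h] obey [S (n + 1) <= h 0 + q S n + M], with [M] the
    sum of [e], hence stay below the fixed point of this affine map. *)
Lemma summable_contraction (q : R) (h e : nat -> R) : 0 <= q < 1 ->
  (forall k, 0 <= h k) -> (forall k, 0 <= e k) ->
  (forall k, h k.+1 <= q * h k + e k) ->
  cvgn (series e) -> cvgn (series h).
Proof.
move=> /andP[q0 q1] h0 e0 he ce; set M := limn (series e).
have eM n : series e n <= M.
  apply: nondecreasing_cvgn_le => //.
  exact: nondecreasing_series.
have M0 : 0 <= M by have := eM 0%N; rewrite seriesEnat/= big_geq.
pose K := (h 0%N + M) / (1 - q).
have KE : K = h 0%N + q * K + M.
  by rewrite /K; field; rewrite subr_eq0 gt_eqF.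
have K0 : 0 <= K by apply: divr_ge0; [exact: addr_ge0|rewrite subr_ge0 ltW].
apply: nondecreasing_is_cvgn; first exact: nondecreasing_series.
exists K => _ [n _ <-].
elim: n => [|n IHn]; first by rewrite seriesEnat/= big_geq.
rewrite seriesEnat/= big_nat_recl// {}[leRHS]KE -addrA lerD2l.
apply: (@le_trans _ _ (q * series h n + series e n)).
  rewrite !seriesEnat/= mulr_sumr -big_split/=.
  by apply: ler_sum => k _; exact: he.
by rewrite lerD// ler_wpM2l.
Qed.

End summable_sequences.

(** * The two sweeps as one step *)

Section sGS_identity.
Context {R : realType} {s : nat} {Y : 'I_s.+1 -> hilbertType R}.
Variable N : 'End(hprod Y).
Let Nd := blkdiag N.
Let Nu := blkupper N.

(** The first block column of a strictly upper triangular operator is zero, so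
    [Nu] does not see the first block, and [Nd], block diagonal and invertible,
    determines the others. The backward sweep says nothing about the first block. *)
Lemma blkupper_eq_tail v w : pd Nd ->
  (forall i : 'I_s.+1, (0 < i)%N -> Nd v i = Nd w i) -> Nu v = Nu w.
Proof.
move=> pdN vw.
pose t := hcut (fun i : 'I_s.+1 => (0 < i)%N) (v - w).
have Nt : Nd t = 0.
  apply: hprodP => i; rewrite hprod0E blkdiagE hcutE; case: ifPn => [i0|_].
    by rewrite -blkdiagE lfunB hprodBE vw// subrr.
  by rewrite linear0 linear0 hprod0E.
have t0 : t = 0 by rewrite -((pd_invK pdN).1 t) Nt linear0.
apply/eqP; rewrite -subr_eq0 -lfunB; apply/eqP/hprodP => i.
rewrite blkupperE (_ : hcut _ _ = 0) ?linear0//.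
apply: hprodP => j; rewrite hcutE hprod0E; case: ifP => // ij.
have := congr1 (fun u : hprod Y => u j) t0.
by rewrite hprod0E hcutE (leq_ltn_trans _ ij).
Qed.

(** Here [q] and [p] are the displacements of the backward sweep and of the full
    step, with errors [dt] and [d]; [a] is the gradient at the starting point and
    [u] the subgradient of the nonsmooth term. Subtracting the two systems gives
    [Nd q = Nd p + Nu^* p - d + dt] outside the first block, which determines
    [Nu q]; inserting it in the second system eliminates [q]. *)
Lemma sGS_identity (p q a u d dt : hprod Y) : self_adjoint N -> pd Nd ->
  (forall i : 'I_s.+1, (0 < i)%N -> u i = 0) ->
  (forall i : 'I_s.+1, (0 < i)%N -> dt i = a i + Nd q i + Nu q i) ->
  (forall i, d i = u i + a i + Nd p i + adjoint Nu p i + Nu q i) ->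
  d + Nu ((Nd^-1)%VF (d - dt)) =
  u + a + N p + Nu ((Nd^-1)%VF (adjoint Nu p)).
Proof.
move=> sN pdN u0 dtE dE; have VK := (pd_invK pdN).2.
have qE : Nu q = Nu p + Nu ((Nd^-1)%VF (adjoint Nu p - (d - dt))).
  rewrite -lfunD; apply: blkupper_eq_tail => // i i0.
  rewrite lfunD VK !(hprodBE, hprodDE) dE dtE// u0//.
  by apply: hdot_inj => w; rewrite !(hdotBr, hdotDr) hdot0r; ring.
have {}dE : d = u + a + Nd p + adjoint Nu p + Nu q.
  by apply: hprodP => i; rewrite dE !hprodDE.
rewrite {1}dE qE (block_splitting p sN) !lfunB.
by apply: hdot_inj => w; rewrite !(hdotBr, hdotDr); ring.
Qed.

End sGS_identity.

(** * Positivity of the proximal operator *)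

Section positivity.
Context {R : realType} {s : nat} {X Z : hilbertType R}.
Context {Y : 'I_s.+1 -> hilbertType R}.
Variables (F : 'Hom(X, hprod Y)) (G : 'Hom(X, Z)).
Variables (Sigma : 'End(hprod Y)) (sigma : R) (D : forall i, 'End(Y i)).
Hypothesis Sigma_psd : psd Sigma.
Hypothesis sigma_gt0 : 0 < sigma.
Hypothesis D_sa : forall i, self_adjoint (D i).
Hypothesis blocks_pd : forall i, pd (2^-1 *: blk Sigma i i +
  sigma *: ((hprj i \o F) \o adjoint (hprj i \o F))%VF + D i).
Hypothesis D_ge : psd (Diag D + 2^-1 *: Sigma).

Let N := calN F Sigma sigma D.

Lemma calNE y : N y = Sigma y + sigma *: F (adjoint F y) + Diag D y.
Proof. by rewrite 2!add_lfunE scale_lfunE comp_lfunE. Qed.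

Lemma calN_sa : self_adjoint N.
Proof.
move=> u v; rewrite !calNE !(hdotDl, hdotDr) hdotZl hdotZr.
have [-> _] := Sigma_psd; rewrite adjointP adjointPr; congr (_ + _).
by rewrite !hdot_hprod; apply: eq_bigr => i _; rewrite !DiagE D_sa.
Qed.

Lemma adjoint_hprj i (u : Y i) : adjoint (hprj i \o F)%VF u = adjoint F (hinj i u).
Proof.
by apply: hdot_inj => x; rewrite -!adjointP comp_lfunE hprjE hdotC -hdot_hinj hdotC.
Qed.

Lemma blocks_dot i (u : Y i) : u != 0 ->
  0 < 2^-1 * '[hinj i u, Sigma (hinj i u)]
      + sigma * '[adjoint F (hinj i u), adjoint F (hinj i u)] + '[u, D i u].
Proof.
move=> u0; have [_ /(_ _ u0)] := blocks_pd i.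
rewrite 2!add_lfunE 2!scale_lfunE !hdotDr !hdotZr blkE -hdot_hinj.
by rewrite [(_ \o adjoint _)%VF _]comp_lfunE -adjointPr adjoint_hprj.
Qed.

Lemma calNd_pd : pd (blkdiag N).
Proof.
have sN := calN_sa; apply: blkdiag_pd => // i; split=> [u v|u u0].
  by rewrite !blkE -hdot_hinj hdotC -hdot_hinj hdotC sN.
rewrite blkE -hdot_hinj calNE !hdotDr hdotZr -(adjointPr F).
have := blocks_dot u0; have [_ /(_ (hinj i u))] := Sigma_psd.
rewrite [X in _ -> _ -> _ < _ + X]hdot_hinj DiagE hinj_in; lra.
Qed.

(** Let [i] be the last nonzero block of [y] and [e] the vector made of that block.
    Row [i] of [N y] reduces to that of [N e]: the part above the diagonal sees only
    zeros, the part below is killed by hypothesis. Comparing with the other two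
    hypotheses gives
    [<e, (Sigma + sigma F F^* + 2 D) e> = 0]. Now [D + Sigma / 2] is
    nonnegative, so both [<e, (D + Sigma / 2) e>] and [|F^* e|] vanish, against the
    definiteness of the diagonal block. *)
Lemma sGS_kernel y : adjoint F y = 0 -> (Diag D + 2^-1 *: Sigma) y = 0 ->
  adjoint (blkupper N) y = 0 -> y = 0.
Proof.
move=> Fy0 Dy0 Ny0; apply: hprodP => i0; rewrite hprod0E.
apply/eqP/negPn/negP => yi0.
have [i yi maxi] := @arg_maxnP _ i0 (fun i => y i != 0) (fun i => i : nat) yi0.
pose e := hinj i (y i).
have e_dot u : '[e, u] = '[y i, u i] by rewrite hdot_hinj.
have NyE : N y i = N e i.
  rewrite (block_splitting y calN_sa) !hprodDE Ny0 hprod0E addr0 blkdiagE.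
  rewrite blkupperE (_ : hcut _ _ = 0) ?linear0 ?hprod0E ?addr0//.
  apply: hprodP => j; rewrite hcutE hprod0E; case: ifP => // ij.
  by apply/eqP; apply: contraTT ij => /maxi; rewrite -leqNgt.
have Dy : '[y i, D i (y i)] + 2^-1 * '[e, Sigma y] = 0.
  have := congr1 (hdot e) Dy0.
  by rewrite add_lfunE scale_lfunE hdotDr hdotZr hdot0r e_dot DiagE.
have De : 0 <= '[y i, D i (y i)] + 2^-1 * '[e, Sigma e].
  have [_ /(_ e)] := D_ge; rewrite add_lfunE scale_lfunE hdotDr hdotZr.
  by rewrite e_dot DiagE hinj_in.
have := congr1 (hdot (y i)) NyE; rewrite -2!e_dot !calNE Fy0 linear0 scaler0 addr0.
rewrite !hdotDr hdotZr -(adjointPr F) [X in _ + X = _]e_dot [X in _ = _ + X]e_dot.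
rewrite !DiagE hinj_in => eN.
have := blocks_dot yi; rewrite -/e => pos.
have : 0 <= sigma * '[adjoint F e, adjoint F e] by rewrite mulr_ge0 ?hdot_ge0 ?ltW.
lra.
Qed.

Lemma calNsGSE y : calNsGS F Sigma sigma D y =
  blkupper N ((blkdiag N)^-1%VF (adjoint (blkupper N) y)).
Proof. by rewrite 2!comp_lfunE. Qed.

Lemma calNsGS_psd : psd (calNsGS F Sigma sigma D).
Proof. exact/psd_congr/pd_psd/pd_inv/calNd_pd. Qed.

Lemma hdot_calV (u v : calV Y G) : '[u, v] = '[u.1, v.1] + '[vsval u.2, vsval v.2].
Proof. by []. Qed.

Lemma calTE v : calT F G Sigma sigma D v =
  (Diag D v.1 + calNsGS F Sigma sigma D v.1
   + sigma *: F (rproj G (adjoint F v.1)), 0) :> calV Y G.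
Proof. by rewrite actYE 2!add_lfunE scale_lfunE !comp_lfunE. Qed.

Lemma calPE v : calP G Sigma v = (Sigma v.1, 0) :> calV Y G.
Proof. exact: actYE. Qed.

Lemma adjoint_calB (v : calV Y G) :
  adjoint (calB F G) v = adjoint F v.1 + adjoint G (vsval v.2).
Proof.
apply: hdot_inj => u; rewrite -adjointP calBE hdot_calV/= vsprojK.
  by rewrite hdotDr !adjointP.
by rewrite memv_img ?memvf.
Qed.

Lemma calT_half_calP_psd : psd (calT F G Sigma sigma D + 2^-1 *: calP G Sigma).
Proof.
have psdA : psd (Diag D + 2^-1 *: Sigma + calNsGS F Sigma sigma D
    + sigma *: (F \o rproj G \o adjoint F)%VF).
  apply: psd_add; first by apply: psd_add => //; exact: calNsGS_psd.
  by apply: psd_scale; [exact: ltW|exact/psd_congr/rproj_psd].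
set A := (A in psd A) in psdA.
have AE v : (calT F G Sigma sigma D + 2^-1 *: calP G Sigma) v =
    (A v.1, 0) :> calV Y G.
  rewrite add_lfunE scale_lfunE calTE calPE /A 3!add_lfunE 2!scale_lfunE.
  rewrite [(F \o _ \o _)%VF _]comp_lfunE [(F \o _)%VF _]comp_lfunE.
  congr (_, _); rewrite /=; last by rewrite scaler0 addr0.
  by apply: hdot_inj => u; rewrite !hdotDr; ring.
have [sA pA] := psdA.
split=> [u v|v]; rewrite !AE hdot_calV/=.
  by rewrite hdot_calV/= hdot0l hdot0r sA.
by rewrite hdot0r addr0.
Qed.

(** The form is the sum of [<y, (D + Sigma / 2) y>], [sigma |F^* y + G^* z|^2],
    [<Nu^* y, Nd^-1 Nu^* y>], and [sigma |Q F^* y|^2], with [Q] the projection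
    [rproj G]. *)
Lemma calT_pos (w : calV Y G) : w != 0 -> 0 < '[w, (2^-1 *: calP G Sigma +
  sigma *: (calB F G \o adjoint (calB F G))%VF + calT F G Sigma sigma D) w].
Proof.
case: w => y z; set w := (y, z) : calV Y G => w0.
pose r := adjoint F y + adjoint G (vsval z).
pose n := adjoint (blkupper N) y.
pose P := rproj G (adjoint F y).
have -> : '[w, (2^-1 *: calP G Sigma +
    sigma *: (calB F G \o adjoint (calB F G))%VF + calT F G Sigma sigma D) w] =
  '[y, (Diag D + 2^-1 *: Sigma) y] + sigma * '[r, r]
  + '[n, (blkdiag N)^-1%VF n] + sigma * '[P, P].
  rewrite 2![in LHS]add_lfunE 2![in LHS]scale_lfunE [in LHS]comp_lfunE.
  rewrite !hdotDr !hdotZr.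
  rewrite -(adjointPr (calB F G)) adjoint_calB -/r calPE calTE !hdot_calV/= !hdot0r.
  rewrite add_lfunE scale_lfunE !hdotDr !hdotZr calNsGSE.
  rewrite -(adjointPr (blkupper N)) -(adjointPr F) -/n -/P.
  have -> : '[adjoint F y, P] = '[P, P] by rewrite hdotC -rproj_dot.
  ring.
have [pdNVsa pdNV] := pd_inv calNd_pd.
have a0 : 0 <= '[y, (Diag D + 2^-1 *: Sigma) y] by case: D_ge.
have r0 : 0 <= sigma * '[r, r] by rewrite mulr_ge0 ?hdot_ge0 ?ltW.
have n0 : 0 <= '[n, (blkdiag N)^-1%VF n].
  by have [_] := pd_psd (pd_inv calNd_pd); exact.
have P0 : 0 <= sigma * '[P, P] by rewrite mulr_ge0 ?hdot_ge0 ?ltW.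
rewrite ltNge; apply/negP => le0; case/negP: w0; apply/eqP.
have sigma0 (u : X) : sigma * '[u, u] <= 0 -> u = 0.
  rewrite pmulr_rle0// => u0; apply/hdot_eq0/le_anti.
  by rewrite u0 hdot_ge0.
have rz : r = 0 by apply: sigma0; lra.
have Pz : P = 0 by apply: sigma0; lra.
have nz : n = 0.
  by apply/eqP/negPn/negP => /pdNV; lra.
(* [Q] fixes [G^* z] and kills [F^* y], so it extracts [G^* z] from [r = 0] *)
have z0 : adjoint G (vsval z) = 0.
  have := congr1 (rproj G) rz.
  by rewrite lfunD rproj_adjoint -/P Pz add0r linear0.
have Fy0 : adjoint F y = 0 by rewrite -rz /r z0 addr0.
have y0 : y = 0.
  apply: sGS_kernel => //; apply: psd_ker => //; lra.
(* [z] lies both in the range of [G] and in the kernel of [G^*] *)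
congr (_, _) => //; apply: val_inj => /=; apply: hdot_eq0.
have /memv_imgP[u _ zE] := subvsP z.
by rewrite {2}zE -adjointPr z0 hdot0l.
Qed.

End positivity.

(** * First-order expansion of the majorized augmented Lagrangian *)

Section lagrangian.
Context {R : realType} {s : nat} {X Z : hilbertType R}.
Context {Y : 'I_s.+1 -> hilbertType R}.
Variables (p : Y ord0 -> \bar R) (f : hprod Y -> R).
Variables (F : 'Hom(X, hprod Y)) (G : 'Hom(X, Z)) (b : Z) (c : X).
Variables (Sigma : 'End(hprod Y)) (sigma : R) (D : forall i, 'End(Y i)).
Hypothesis Sigma_psd : psd Sigma.
Hypothesis sigma_gt0 : 0 < sigma.

Local Notation Lag := (Lag p f F G b c Sigma sigma).
Local Notation res := (residual F G c).
Local Notation N := (calN F Sigma sigma D).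

(** The augmented Lagrangian without the term [p]: a convex quadratic in [(y, z)],
    whose partial gradients are [gradY] and [gamma_at] and whose second-order part
    is [curvature] ([smooth_part_expand]). *)
Definition smooth_part (x : X) (y' y : hprod Y) (z : Z) : R :=
  fhat f Sigma y y' - '[b, z] + '[res y z, x] + sigma / 2 * `|res y z| ^+ 2.

Definition gradY (x : X) (y' y : hprod Y) (z : Z) : hprod Y :=
  grad f y' + Sigma (y - y') + F (x + sigma *: res y z).

Definition curvature (h : hprod Y) (k : Z) : R :=
  2^-1 * '[h, Sigma h] + sigma / 2 * `|adjoint F h + adjoint G k| ^+ 2.

Lemma curvature_ge0 h k : 0 <= curvature h k.
Proof.
have [_ Sh] := Sigma_psd.
by rewrite addr_ge0 ?mulr_ge0 ?invr_ge0 ?sqr_ge0 ?Sh// ltW.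
Qed.

Lemma residualD y z h k : res (y + h) (z + k) = res y z + (adjoint F h + adjoint G k).
Proof.
by apply: hdot_inj => w; rewrite /residual !lfunD !(hdotBr, hdotDr); ring.
Qed.

Lemma smooth_part_expand x y' y z h k :
  smooth_part x y' (y + h) (z + k) = smooth_part x y' y z +
    '[gradY x y' y z, h] + '[gamma_at F G b c sigma x y z, k] + curvature h k.
Proof.
rewrite /smooth_part /gradY /gamma_at /curvature /fhat /opsqnorm.
rewrite residualD (_ : y + h - y' = (y - y') + h); last by rewrite addrAC.
set a := y - y'; set r := res y z; set t := adjoint F h + adjoint G k.
have tE u : '[t, u] = '[u, adjoint F h] + '[u, adjoint G k].
  by rewrite hdotC hdotDr.
have aE : '[a, Sigma h] = '[Sigma a, h] by have [-> _] := Sigma_psd.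
clearbody a r t; rewrite -!hdot_norm !(hdotDl r t) !(hdotDr _ r t) (hdotC r t).
move: '[t, t] => tt.
rewrite !(hdotBl, hdotDl, hdotDr, lfunD, lfunZ, hdotZl) aE (hdotC h (Sigma a)).
by rewrite !(adjointP F) !(adjointP G) !tE; field.
Qed.

Lemma gradY_shift x y' y z k :
  gradY x y' y (z + k) = gradY x y' y z + sigma *: F (adjoint G k).
Proof.
rewrite /gradY; have -> : res y (z + k) = res y z + adjoint G k.
  by rewrite -{1}[y]addr0 residualD linear0 add0r.
by rewrite scalerDr (addrA x) (lfunD F) (lfunZ F) addrA.
Qed.

Lemma gradY_calN x y' y z : gradY x y' y z + Diag D (y - y') =
  gradY x y' y' z + N (y - y').
Proof.
have [h ->] : exists h, y = y' + h by exists (y - y'); rewrite addrC subrK.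
rewrite /gradY; have -> : res (y' + h) z = res y' z + adjoint F h.
  by rewrite -{1}[z]addr0 residualD linear0 addr0.
rewrite [y' + h - y']addrAC subrr add0r linear0 addr0 calNE.
rewrite scalerDr (addrA x) (lfunD F) (lfunZ F).
by apply: hdot_inj => w; rewrite !hdotDr; ring.
Qed.

Lemma gradY_calN_block x y' y z i :
  gradY x y' y z i + D i (y i - y' i) = gradY x y' y' z i + N (y - y') i.
Proof. by rewrite -hprodBE -DiagE -!hprodDE gradY_calN. Qed.

Lemma block_subdiff x y' z y1 y2 i u0 g :
  convex_efun (fun u => p (splice y1 y2 i u ord0)) ->
  subdiff (fun u => Lag (splice y1 y2 i u) z x y') u0 g ->
  subdiff (fun u => p (splice y1 y2 i u ord0)) u0
    (g - gradY x y' (splice y1 y2 i u0) z i).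
Proof.
move=> cP; apply: (@subdiff_sub_smooth _ _ _
  (fun u => smooth_part x y' (splice y1 y2 i u) z)
  (fun h => curvature (hinj i h) 0)) => // [h|t h].
  rewrite (splice_shift _ _ u0) (addrAC u0) subrr add0r -{1}(addr0 z).
  by rewrite smooth_part_expand hdot0r addr0 (hdotC (gradY _ _ _ _)) hdot_hinj hdotC.
rewrite /curvature linear0 !addr0 !lfunZ hdotZl hdotZr normrZ.
by rewrite exprMn real_normK ?num_real//; ring.
Qed.

(** Away from the first block the nonsmooth term is constant, so that a subgradient
    is the partial gradient. *)
Lemma block_gradient x y' z y1 y2 (i : 'I_s.+1) u0 g : (0 < i)%N ->
  subdiff (fun u => Lag (splice y1 y2 i u) z x y') u0 g ->
  g = gradY x y' (splice y1 y2 i u0) z i.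
Proof.
move=> i0 gP; have pE u : p (splice y1 y2 i u ord0) = p (y1 ord0).
  by rewrite splice_lt.
have /funext pcst := pE; apply/eqP; rewrite -subr_eq0; apply/eqP.
apply: (@subdiff_cst _ _ (p (y1 ord0)) u0); rewrite -pcst.
apply: (block_subdiff _ (gP)); rewrite pcst; apply: convex_efun_cst.
by case: gP; rewrite -(pE u0) fin_numD => /andP[].
Qed.

Lemma block0_subdiff x y' z y1 y2 u0 g : convex_efun p ->
  subdiff (fun u => Lag (splice y1 y2 ord0 u) z x y') u0 g ->
  subdiff p u0 (g - gradY x y' (splice y1 y2 ord0 u0) z ord0).
Proof.
have /funext pE u : p (splice y1 y2 ord0 u ord0) = p u by rewrite splice_in.
by move=> cp gP; rewrite -[X in subdiff X]pE; apply: block_subdiff gP; rewrite pE.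
Qed.

(** The constraint only sees [z] through [G^* z], so replacing [z] by its projection
    onto the range of [G] changes no residual. *)
Lemma adjoint_mproj z : adjoint G (vsval (mproj (limg G) z)) = adjoint G z.
Proof.
apply: hdot_inj => x; rewrite -!adjointP; apply/eqP.
rewrite eq_sym -subr_eq0 -hdotBr; apply/eqP/mprojP.
by rewrite memv_img ?memvf.
Qed.

Lemma residual_mproj y z : res y (vsval (mproj (limg G) z)) = res y z.
Proof. by rewrite /residual adjoint_mproj. Qed.

(** Converse direction of the blockwise analysis: the smooth part is jointly convex
    in [(y, z)], so a subgradient of [p] in the first block plus the full gradient
    is a subgradient of the joint objective. *)
Lemma LagV_subdiff x (y' y1 : hprod Y) z' z1 u :
  subdiff p (y1 ord0) u -> gamma_at F G b c sigma x y1 z1 \in limg G ->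
  subdiff (fun w => LagV p f F G b c Sigma sigma w x ((y', z') : calV Y G))
    ((y1, mproj (limg G) z1) : calV Y G)
    (inV G (hinj ord0 u + gradY x y' y1 z1) (gamma_at F G b c sigma x y1 z1)).
Proof.
move=> [pfin up] gamG; set v1 := (y1, _) : calV Y G.
set gam := gamma_at _ _ _ _ _ _ _ _ in gamG *.
have -> : inV G (hinj ord0 u + gradY x y' y1 z1) gam =
    ((hinj ord0 u, 0) : calV Y G) + inV G (gradY x y' y1 z1) gam.
  by rewrite /inV; congr (_, _); rewrite /= add0r.
apply: (@subdiff_add_smooth _ _ (fun w : calV Y G => p (w.1 ord0))
  (fun w : calV Y G => smooth_part x y' w.1 (vsval w.2))).
  split=> // w; rewrite hdot_calV/= hdot0l addr0 hdot_hinj hprodBE.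
  exact: up.
move=> w; have -> : smooth_part x y' w.1 (vsval w.2) =
  smooth_part x y' (v1.1 + (w.1 - v1.1)) (vsval v1.2 + (vsval w.2 - vsval v1.2)).
  by congr smooth_part; rewrite addrC subrK.
rewrite smooth_part_expand hdot_calV/= vsprojK//.
rewrite (_ : gamma_at _ _ _ _ _ _ _ _ = gam); last first.
  by rewrite /gamma_at residual_mproj.
rewrite (_ : gradY _ _ _ (vsval _) = gradY x y' y1 z1); last first.
  by rewrite /gradY residual_mproj.
by rewrite [leLHS]addrA lerDl curvature_ge0.
Qed.

End lagrangian.

(** * The inexact optimality condition *)

Section iteration.
Context {R : realType} {s : nat} {X Z : hilbertType R}.
Context {Y : 'I_s.+1 -> hilbertType R}.
Variables (p : Y ord0 -> \bar R) (f : hprod Y -> R).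
Variables (F : 'Hom(X, hprod Y)) (G : 'Hom(X, Z)) (b : Z) (c : X).
Variables (Sigma : 'End(hprod Y)) (sigma tau : R) (D : forall i, 'End(Y i)).
Variables (eps : nat -> R) (x : nat -> X) (y yh : nat -> hprod Y) (z : nat -> Z).
Variables (dt d : nat -> hprod Y).
Hypothesis p_convex : convex_efun p.
Hypothesis Sigma_psd : psd Sigma.
Hypothesis D_sa : forall i, self_adjoint (D i).
Hypothesis blocks_pd : forall i, pd (2^-1 *: blk Sigma i i +
  sigma *: ((hprj i \o F) \o adjoint (hprj i \o F))%VF + D i).
Hypothesis alg : sGS_iPADMM p f F G b c Sigma sigma tau D eps x y yh z dt d.

Local Notation res := (residual F G c).
Local Notation N := (calN F Sigma sigma D).
Local Notation Dlt := (Delta F G b c Sigma sigma tau D x y z dt d).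
Local Notation gam := (gamma F G b c sigma x y z).
Local Notation grd := (gradY f F G c Sigma sigma).

Lemma dtilde0 k : dtilde dt d k ord0 = d k ord0.
Proof. by rewrite ffunE eqtype.dfwith_in. Qed.

Lemma dtilde_gt0 k (i : 'I_s.+1) : (0 < i)%N -> dtilde dt d k i = dt k i.
Proof. by move=> i0; rewrite ffunE eqtype.dfwith_out// -val_eqE/= ltn_eqF. Qed.

Lemma half_stepE k (i : 'I_s.+1) : (0 < i)%N ->
  dt k i = grd (x k) (y k) (y k) (z k) i
           + blkdiag N (yh k - y k) i + blkupper N (yh k - y k) i.
Proof.
move=> i0; have [g gP <-] := half_step alg k i0.
rewrite (block_gradient Sigma_psd i0 gP).
have := gradY_calN_block f F G c Sigma sigma D (x k) (y k)
  (splice (y k) (yh k) i (yh k i)) (z k) i.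
rewrite splice_in => ->; rewrite -!addrA; congr (_ + _).
rewrite splice_sub_ge hcut_ge (lfunD N) blkdiagE blkupperE.
exact: hprodDE.
Qed.

Lemma full_stepE k (u : hprod Y) i :
  let w := splice (y k.+1) (yh k) i (y k.+1 i) in
  d k i = u i + grd (x k) (y k) w (z k) i + D i (y k.+1 i - y k i) ->
  d k i = u i + grd (x k) (y k) (y k) (z k) i + blkdiag N (y k.+1 - y k) i
          + adjoint (blkupper N) (y k.+1 - y k) i + blkupper N (yh k - y k) i.
Proof.
have := gradY_calN_block f F G c Sigma sigma D (x k) (y k)
  (splice (y k.+1) (yh k) i (y k.+1 i)) (z k) i.
rewrite splice_in => E w ->; rewrite -addrA E -!addrA; congr (_ + (_ + _)).
rewrite splice_sub hcut_le 2!(lfunD N) blkdiagE blkupperE.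
rewrite adjoint_blkupperE; last exact: calN_sa.
set e := hinj i _; set u1 := hcut _ _; set u2 := hcut _ _.
by rewrite (hprodDE (N e + N u1)) (hprodDE (N e)) addrA.
Qed.

(** The error [dsGS] is designed for this elimination of the half-step [yh]: what
    remains is the gradient at the new [y], still with the old [z], plus a proximal
    term. *)
Lemma dsGSE k : exists2 u, subdiff p (y k.+1 ord0) u &
  dsGS F Sigma sigma D dt d k = hinj ord0 u + grd (x k) (y k) (y k.+1) (z k)
    + (Diag D (y k.+1 - y k) + calNsGS F Sigma sigma D (y k.+1 - y k)).
Proof.
have [g0 g0P d0] := full_step alg k ord0.
have {}g0P := block0_subdiff Sigma_psd p_convex g0P.
set u0 := (_ - _) in g0P; exists u0 => //.
rewrite /dsGS (@sGS_identity _ _ _ _ (y k.+1 - y k) (yh k - y k)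
  (grd (x k) (y k) (y k) (z k)) (hinj ord0 u0)); last first.
- move=> i; apply: full_stepE; have [->|i0] := eqVneq i ord0.
    by rewrite -d0 hinj_in /u0 subrK.
  have {}i0 : (0 < i)%N by rewrite lt0n.
  have [g gP <-] := full_step alg k i.
  rewrite (block_gradient Sigma_psd i0 gP) hinj_out ?add0r//.
  by rewrite -val_eqE/= ltn_eqF.
- by move=> i i0; rewrite dtilde_gt0// half_stepE.
- by move=> i i0; rewrite hinj_out// -val_eqE/= ltn_eqF.
- exact: calNd_pd.
- exact: calN_sa.
rewrite calNsGSE [RHS]addrA; congr (_ + _).
by rewrite -!(addrA (hinj _ _)) -gradY_calN.
Qed.

(** The combination entering [Delta] is arranged so that the multipliers cancel;
    they do so whatever the previous point is, so that the convention made for it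
    at [k = 0] needs no separate treatment. *)
Lemma gamma_diff k : gamma_prev F G b c sigma tau x y z k - gam k -
    G (x_prev F G c sigma tau x y z k - x k) =
  G (sigma *: res (y k) (z k)) - G (sigma *: res (y k.+1) (z k.+1)).
Proof.
rewrite /gamma_prev /gamma /gamma_at.
move: (x_prev _ _ _ _ _ _ _ _ _) (res (y k) (z k)) (res (y k.+1) (z k.+1)) => u r r'.
rewrite !(lfunB G) !(lfunZ G).
by apply: hdot_inj => w; rewrite !(hdotBr, hdotDr); ring.
Qed.

(** Passing from the old [z] to the new one: with [Q = rproj G], the correction in
    [Delta] is [Q] applied to [F^*(y^k - y^{k+1}) + G^*(z^k - z^{k+1})]; [Q] fixes
    the second part, which makes up for the change of [z], and the first one
    becomes a proximal term. *)
Lemma DeltaE k : exists2 u, subdiff p (y k.+1 ord0) u &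
  Dlt k = hinj ord0 u + grd (x k) (y k) (y k.+1) (z k.+1)
    + (Diag D (y k.+1 - y k) + calNsGS F Sigma sigma D (y k.+1 - y k)
       + sigma *: F (rproj G (adjoint F (y k.+1 - y k)))).
Proof.
have [u uP dE] := dsGSE k; exists u => //.
rewrite /Delta gamma_diff dE -(lfunB G) -scalerBr -rprojE.
have -> : res (y k) (z k) - res (y k.+1) (z k.+1) =
    - adjoint F (y k.+1 - y k) - adjoint G (z k.+1 - z k).
  rewrite /residual !lfunB.
  by apply: hdot_inj => w; rewrite !(hdotBr, hdotNr, hdotDr); ring.
have -> : grd (x k) (y k) (y k.+1) (z k.+1) = grd (x k) (y k) (y k.+1) (z k)
    + sigma *: F (adjoint G (z k.+1 - z k)).
  by rewrite -gradY_shift addrC subrK.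
rewrite -opprD scalerN (lfunN (rproj G)) (lfunN F) opprK.
rewrite (lfunZ (rproj G)) (lfunZ F) (lfunD (rproj G)) (lfunD F) rproj_adjoint.
move: (F (rproj _ _)) (F (adjoint _ _)) (grd _ _ _ _) (calNsGS _ _ _ _ _) => a e g n.
by apply: hdot_inj => w; rewrite !(hdotDr, hdotZr); ring.
Qed.

End iteration.

(** * Summability of the errors *)

Section error_bounds.
Context {R : realType} {s : nat} {X Z : hilbertType R}.
Context {Y : 'I_s.+1 -> hilbertType R}.

Lemma hprod_norm_le (v : hprod Y) (e : R) :
  (forall i, `|v i| <= e) -> `|v| <= s.+1%:R * e.
Proof.
move=> ve; have -> : v = \sum_i hinj i (v i).
  by apply: hprodP => j; rewrite -(hcut_sum predT) hcutE.
apply: (le_trans (ler_norm_sum _ _ _)).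
rewrite mulr_natl -[X in _ *+ X]card_ord -sumr_const; apply: ler_sum => i _.
apply: le_trans (ve i); rewrite -(@ler_pXn2r _ 2)// ?nnegrE//.
by rewrite -!hdot_norm hdot_hinj hinj_in.
Qed.

Lemma inV_norm_le (G : 'Hom(X, Z)) (a : hprod Y) t : t \in limg G ->
  `|inV G a t| <= `|a| + `|t|.
Proof.
move=> tG; rewrite -(@ler_pXn2r _ 2)// ?nnegrE ?addr_ge0//.
rewrite -hdot_norm hdot_calV/= vsprojK// !hdot_norm sqrrD -addrA lerD2l lerDr.
by rewrite mulrn_wge0// mulr_ge0.
Qed.

Variables (p : Y ord0 -> \bar R) (f : hprod Y -> R).
Variables (F : 'Hom(X, hprod Y)) (G : 'Hom(X, Z)) (b : Z) (c : X).
Variables (Sigma : 'End(hprod Y)) (sigma tau : R) (D : forall i, 'End(Y i)).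
Variables (eps : nat -> R) (x : nat -> X) (y yh : nat -> hprod Y) (z : nat -> Z).
Variables (dt d : nat -> hprod Y).
Hypothesis tau_gt0 : 0 < tau.
Hypothesis tau_lt2 : tau < 2.
Hypothesis eps_ge0 : forall k, 0 <= eps k.
Hypothesis eps_summable : cvgn (series eps).
Hypothesis alg : sGS_iPADMM p f F G b c Sigma sigma tau D eps x y yh z dt d.

Local Notation res := (residual F G c).
Local Notation Dlt := (Delta F G b c Sigma sigma tau D x y z dt d).
Local Notation gam := (gamma F G b c sigma x y z).

Lemma dsGS_bound : exists2 M, 0 <= M &
  forall k, `|dsGS F Sigma sigma D dt d k| <= M * eps k.
Proof.
have [M M0 MP] := lfun_bounded
  (blkupper (calN F Sigma sigma D) \o (blkdiag (calN F Sigma sigma D))^-1)%VF.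
exists (s.+1%:R + M * (s.+1%:R * 2)) => [|k].
  by rewrite addr_ge0 ?mulr_ge0.
rewrite /dsGS mulrDl; apply: (le_trans (ler_normD _ _)); apply: lerD.
  exact: hprod_norm_le (full_err alg k).
rewrite -[X in `|X|]comp_lfunE; apply: (le_trans (MP _)).
rewrite -!mulrA ler_wpM2l//; apply: hprod_norm_le => i; rewrite hprodBE.
have [->|i0] := eqVneq i ord0.
  by rewrite dtilde0 subrr normr0 mulr_ge0.
have {}i0 : (0 < i)%N by rewrite lt0n.
rewrite dtilde_gt0//; apply: (le_trans (ler_normB _ _)).
by rewrite mulrDl !mul1r lerD// ?(full_err alg) ?(half_err alg).
Qed.

(** The multiplier step is [x^{k+1} = x^k + tau sigma r_{k+1}] and
    [gamma^k = (G x^k - b) + sigma G r_{k+1}], with [r_{k+1}] the new residual, so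
    the dual residual is relaxed towards [gamma^k] with parameter [tau]; the factor
    [|1 - tau|] is less than [1] exactly when [0 < tau < 2]. *)
Lemma dual_step k : G (x k.+1) - b = (1 - tau) *: (G (x k) - b) + tau *: gam k.
Proof.
rewrite (x_step alg) /gamma /gamma_at.
move: (res (y k.+1) (z k.+1)) => r; rewrite (lfunD G) (lfunZ G).
by apply: hdot_inj => w; rewrite !(hdotBr, hdotDr, hdotZr); ring.
Qed.

Lemma dual_residual_summable : cvgn (series (fun k => `|G (x k) - b|)).
Proof.
apply: (@summable_contraction _ `|1 - tau| _ (fun k => tau * eps k)) => //.
- rewrite normr_ge0 ltr_norml; move: tau_gt0 tau_lt2 => t0 t2.
  by apply/andP; split; lra.
- by move=> k; rewrite mulr_ge0// ltW.
- move=> k; rewrite dual_step; apply: (le_trans (ler_normD _ _)).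
  by rewrite !normrZ lerD2l (gtr0_norm tau_gt0) ler_wpM2l ?(z_step alg)// ltW.
exact: is_cvg_seriesZ.
Qed.

Lemma primal_residual_le k : `|G (sigma *: res (y k.+1) (z k.+1))| <=
  eps k + `|G (x k) - b|.
Proof.
have -> : G (sigma *: res (y k.+1) (z k.+1)) = gam k - (G (x k) - b).
  by rewrite /gamma /gamma_at addrAC subrr add0r (lfunZ G).
by apply: (le_trans (ler_normB _ _)); rewrite lerD2r (z_step alg).
Qed.

Lemma primal_residual_summable :
  cvgn (series (fun k => `|G (sigma *: res (y k) (z k))|)) /\
  cvgn (series (fun k => `|G (sigma *: res (y k.+1) (z k.+1))|)).
Proof.
have sum_ge0 k : 0 <= eps k + `|G (x k) - b| by rewrite addr_ge0.
have sum_cvg : cvgn (series (fun k => eps k + `|G (x k) - b|)).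
  by apply: is_cvg_seriesD => //; exact: dual_residual_summable.
split; last exact: series_le_cvg (primal_residual_le) sum_cvg.
(* with contraction factor [0], summability passes from the shifted sequence *)
apply: (@summable_contraction _ 0 _ (fun k => eps k + `|G (x k) - b|)) => //.
  by rewrite lexx ltr01.
by move=> k; rewrite mul0r add0r primal_residual_le.
Qed.

Lemma Delta_gamma_summable : (forall k, gam k \in limg G) ->
  cvgn (series (fun k => `|inV G (Dlt k) (gam k)|)).
Proof.
move=> gamG; have [M M0 MP] := dsGS_bound.
have [K K0 KP] := lfun_bounded
  (F \o adjoint G \o Defs.pinv (G \o adjoint G)%VF)%VF.
pose r k := `|G (sigma *: res (y k) (z k))|.
have [rc rSc] : cvgn (series r) /\ cvgn (series (fun k => r k.+1)).
  exact: primal_residual_summable.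
apply: (@series_le_cvg _ _
  (fun k => (M + 1) * eps k + K * (r k + r k.+1))) => [k|k|k|] //.
- by rewrite !(addr_ge0, mulr_ge0) ?eps_ge0 //; exact: normr_ge0.
- apply: (le_trans (inV_norm_le _ (gamG k))).
  apply: (@le_trans _ _ ((M * eps k + K * (r k + r k.+1)) + eps k)); last lra.
  apply: lerD; last exact: z_step alg k.
  apply: (le_trans (ler_normB _ _)); apply: lerD => //.
  rewrite gamma_diff.
  have -> t : F (adjoint G (Defs.pinv (G \o adjoint G)%VF t)) =
      (F \o adjoint G \o Defs.pinv (G \o adjoint G)%VF)%VF t.
    by rewrite 2!comp_lfunE.
  by apply: (le_trans (KP _)); rewrite ler_wpM2l// ler_normB.
apply: is_cvg_seriesD; apply: is_cvg_seriesZ => //.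
exact: is_cvg_seriesD.
Qed.

(** The hypothesis is the dual equation of a KKT point. *)
Lemma gamma_limg x0 : G x0 = b -> forall k, gam k \in limg G.
Proof.
move=> <- k; rewrite /gamma /gamma_at -(lfunB G) -(lfunZ G) -(lfunD G).
by rewrite memv_img ?memvf.
Qed.

End error_bounds.

Theorem theorem4p1 (R : realType) (s : nat) (X Z : hilbertType R)
    (Y : 'I_s.+1 -> hilbertType R)
    (p : Y ord0 -> \bar R) (f : hprod Y -> R)
    (F : 'Hom(X, hprod Y)) (G : 'Hom(X, Z)) (b : Z) (c : X)
    (Sigma : 'End(hprod Y)) (sigma tau : R) (D : forall i, 'End(Y i))
    (eps : nat -> R) (x : nat -> X) (y yh : nat -> hprod Y) (z : nat -> Z)
    (dt d : nat -> hprod Y)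
    (p_proper : proper_efun p)
    (p_convex : convex_efun p)
    (p_closed : lower_semicontinuous p)
    (f_convex : convex_function [set: hprod Y] f)
    (f_diff : forall y0, differentiable f y0)
    (f_C1 : continuous (grad f))
    (f_lip : lipschitz (grad f))
    (Sigma_psd : psd Sigma)
    (Sigma_major : forall y1 y2, f y1 <= fhat f Sigma y1 y2)
    (sigma_gt0 : 0 < sigma)
    (tau_gt0 : 0 < tau) (tau_lt2 : tau < 2)
    (eps_ge0 : forall k, 0 <= eps k)
    (eps_summable : cvgn (series eps))
    (kkt_nonempty : exists x0 y0 z0, kkt p f F G b c x0 y0 z0)
    (D_sa : forall i, self_adjoint (D i))
    (blocks_pd : forall i, pd (2^-1 *: blk Sigma i i +
       sigma *: ((hprj i \o F) \o adjoint (hprj i \o F))%VF + D i))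
    (D_ge : psd (Diag D + 2^-1 *: Sigma))
    (alg : sGS_iPADMM p f F G b c Sigma sigma tau D eps x y yh z dt d) :
  let T := calT F G Sigma sigma D in
  let P := calP G Sigma in
  let B := calB F G in
  let Dlt := Delta F G b c Sigma sigma tau D x y z dt d in
  let gam := gamma F G b c sigma x y z in
  let v := vseq G y z in
  [/\ psd (T + 2^-1 *: P) ,
      (forall w, w != 0 ->
         0 < '[w, (2^-1 *: P + sigma *: (B \o adjoint B)%VF + T) w]),
      (forall k, gam k \in limg G) &
      exists ehat : nat -> R,
        [/\ forall k, 0 <= ehat k,
            forall k, `|inV G (Dlt k) (gam k)| <= ehat k,
            cvgn (series ehat) &
            forall k,
              [set g + T (v k.+1 - v k) | g in
                 subdiff (fun w => LagV p f F G b c Sigma sigma w (x k) (v k))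
                         (v k.+1)] (inV G (Dlt k) (gam k)) /\
              `|inV G (Dlt k) (gam k)| <= ehat k]].
Proof.
move=> T P B Dlt gam v.
have [x0 [y0 [z0 [_ /eqP Gb _]]]] := kkt_nonempty.
have gamG : forall k, gam k \in limg G.
  by apply: (@gamma_limg _ _ _ _ _ F G b c sigma x y z x0); apply/eqP; rewrite -subr_eq0.
split => //.
- exact: calT_half_calP_psd.
- exact: calT_pos.
exists (fun k => `|inV G (Dlt k) (gam k)|); split=> //.
  exact: (Delta_gamma_summable tau_gt0 tau_lt2 eps_ge0 eps_summable alg).
move=> k; split=> //.
have [u up DltE] := DeltaE p_convex Sigma_psd D_sa blocks_pd alg k.
exists (inV G (hinj ord0 u + gradY f F G c Sigma sigma (x k) (y k) (y k.+1) (z k.+1))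
  (gam k)).
  exact: (LagV_subdiff f Sigma_psd sigma_gt0 (y k) (mproj (limg G) (z k)) up (gamG k)).
rewrite /T calTE /Dlt DltE /inV; congr (_, _) => /=.
by rewrite addr0.
Qed.
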